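(* For $0 < x < 1$, let $R(1,x) = \prod_{n=1}^\infty (1-x^n)$ and $$R_0(1,x) = e^{\pi^2/(6\log x)} \left( 1 + \frac{4\pi^2}{(\log x)^2} \right)^{1/4}.$$ Then for all $0<x<1$, $$ e^{\pi^2/(6\log x)} \;<\; R_0(1,x) \;<\; R(1,x) \;\le\; C\, R_0(1,x), $$ where $C = e^{\pi/6}\, 2^{-1/4}\, \eta(i)$ (numerically $C \approx 1.090504$).
   Context: $\log$ is the natural logarithm. $\eta$ is the Dedekind eta function, $\eta(\tau) = e^{\pi i \tau/12}\prod_{n=1}^\infty (1-e^{2\pi i n\tau})$ for $\operatorname{Im}\tau>0$; in particular $\eta(i) = e^{-\pi/12}\prod_{n=1}^\infty(1-e^{-2\pi n})$. *)

(* Defs.v *)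
From Stdlib Require Import Reals.
From Coquelicot Require Import Coquelicot.
Open Scope R_scope.

(* a 1 * ... * a N; the indexing of all products starts at 1. *)
Fixpoint partial_prod (a : nat -> R) (N : nat) : R :=
  match N with
  | O => 1
  | S m => partial_prod a m * a (S m)
  end.

Definition inf_prod (a : nat -> R) : R := real (Lim_seq (partial_prod a)).

Fixpoint Cpartial_prod (a : nat -> C) (N : nat) : C :=
  match N with
  | O => RtoC 1
  | S m => Cmult (Cpartial_prod a m) (a (S m))
  end.

(* A limit in C is the pair of the limits of real and imaginary parts. *)
Definition Cinf_prod (a : nat -> C) : C :=
  (real (Lim_seq (fun N => Re (Cpartial_prod a N))),
   real (Lim_seq (fun N => Im (Cpartial_prod a N)))).

Definition Cexp (z : C) : C := (exp (Re z) * cos (Im z), exp (Re z) * sin (Im z)).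

(* Meaningful only on the upper half-plane 0 < Im tau. *)
Definition dedekind_eta (tau : C) : C :=
  (Cexp (RtoC PI * Ci * tau / RtoC 12) *
   Cinf_prod (fun n => RtoC 1 - Cexp (RtoC 2 * RtoC PI * Ci * RtoC (INR n) * tau)))%C.

(* R(1, x) and R_0(1, x). *)
Definition R_1 (x : R) : R := inf_prod (fun n => 1 - x ^ n).

Definition R0_1 (x : R) : R :=
  exp (PI ^ 2 / (6 * ln x)) * Rpower (1 + 4 * PI ^ 2 / (ln x) ^ 2) (1 / 4).

(* dedekind_eta Ci is a real number, so taking its real part loses nothing. *)
Definition C_const : R := exp (PI / 6) * Rpower 2 (- (1 / 4)) * Re (dedekind_eta Ci).

(* Main.v *)
(* Put u = - 2 pi / ln x and log_ratio u = ln (R(1,x) / R_0(1,x)). The transformation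
   eta(-1/tau) = sqrt(-i tau) eta(tau) on the imaginary axis says exactly that log_ratio is
   invariant under u -> 1/u, so only 0 < u <= 1 matters, where x <= e^(-2 pi) is tiny. There
   positivity is a crude estimate. Moreover log_ratio is concave on (0,1], and its Euler product
   part is concave even beyond 1; with the symmetry this forces the maximum to be at u = 1,
   i.e. x = e^(-2 pi), where the value is ln C.

   For the transformation, - ln R(1, e^(-s)) = sum_k 1 / (k (e^(ks) - 1)). The partial fraction
   expansion of 1 / (e^y - 1), obtained by iterating the duplication identity of the Poisson
   kernel, turns this into a double sum that is symmetric under s -> 4 pi^2 / s up to the order
   of summation. *)
Require Import Defs.
From Stdlib Require Import Reals Lra Lia.
From Coquelicot Require Import Coquelicot.
Open Scope R_scope.

(** * Finite sums *)

(** In the variable u the second factor of R_0 is (1 + u^2)^(1/4). Since ln(1 + u^2) - ln(1 +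
    u^(-2)) = 2 ln u, this factor absorbs exactly the square root in the transformation, which is
    why [log_ratio] is invariant under u -> 1/u. Invariance and concavity on (0,1] alone do not
    locate the maximum: 1 - u on (0,1], extended by symmetry, has a minimum with a kink at 1. Nor
    does concavity of [log_ratio] extend by the same argument beyond 1, because ln(1 + u^2) is
    convex only up to there. What has to be added is that the slope at 1 vanishes. This is obtained
    without differentiating the infinite product: the logarithm of each Euler factor is concave for
    u <= 3, concavity passes to the limit of partial sums, and averaging the values at w and 1/w
    shows that [log_ratio] w exceeds [log_ratio] 1 by at most a multiple of (1 - w)^2. *)

Fixpoint psum (a : nat -> R) (N : nat) : R :=
  match N with
  | O => 0
  | S m => psum a m + a (S m)
  end.

Lemma psum_ext (a b : nat -> R) (N : nat) :
  (forall k, (1 <= k <= N)%nat -> a k = b k) -> psum a N = psum b N.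
Proof.
induction N as [|N IH]; intros H; simpl; [reflexivity|].
rewrite IH, H; [reflexivity|lia|intros; apply H; lia].
Qed.

Lemma psum_le (a b : nat -> R) (N : nat) :
  (forall k, (1 <= k <= N)%nat -> a k <= b k) -> psum a N <= psum b N.
Proof.
induction N as [|N IH]; intros H; simpl; [lra|].
apply Rplus_le_compat; [apply IH; intros; apply H; lia|apply H; lia].
Qed.

Lemma psum_plus (a b : nat -> R) (N : nat) :
  psum (fun k => a k + b k) N = psum a N + psum b N.
Proof. induction N as [|N IH]; simpl; [ring|rewrite IH; ring]. Qed.

Lemma psum_minus (a b : nat -> R) (N : nat) :
  psum (fun k => a k - b k) N = psum a N - psum b N.
Proof. induction N as [|N IH]; simpl; [ring|rewrite IH; ring]. Qed.

Lemma psum_scal (c : R) (a : nat -> R) (N : nat) :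
  psum (fun k => c * a k) N = c * psum a N.
Proof. induction N as [|N IH]; simpl; [ring|rewrite IH; ring]. Qed.

Lemma psum_const (c : R) (N : nat) : psum (fun _ => c) N = INR N * c.
Proof. induction N as [|N IH]; [simpl; ring|]. rewrite S_INR; simpl; rewrite IH; ring. Qed.

Lemma psum_nonneg (a : nat -> R) (N : nat) :
  (forall k, (1 <= k)%nat -> 0 <= a k) -> 0 <= psum a N.
Proof.
intros H; induction N as [|N IH]; simpl; [lra|].
apply Rplus_le_le_0_compat; [exact IH|apply H; lia].
Qed.

Lemma psum_abs (a : nat -> R) (N : nat) :
  Rabs (psum a N) <= psum (fun k => Rabs (a k)) N.
Proof.
induction N as [|N IH]; simpl; [rewrite Rabs_R0; lra|].
eapply Rle_trans; [apply Rabs_triang|lra].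
Qed.

Lemma psum_add (a : nat -> R) (M N : nat) :
  psum a (M + N) = psum a M + psum (fun k => a (M + k)%nat) N.
Proof.
induction N as [|N IH]; simpl; [rewrite Nat.add_0_r; ring|].
rewrite Nat.add_succ_r; simpl; rewrite IH; ring.
Qed.

Lemma psum_exchange (a : nat -> nat -> R) (M N : nat) :
  psum (fun i => psum (a i) N) M = psum (fun j => psum (fun i => a i j) M) N.
Proof.
induction M as [|M IH]; simpl.
- rewrite psum_const; ring.
- rewrite IH, <- psum_plus; apply psum_ext; intros; ring.
Qed.

Lemma psum_shift (a : nat -> R) (N : nat) :
  psum a (S N) = a 1%nat + psum (fun k => a (S k)) N.
Proof. rewrite <- (Nat.add_1_l N), psum_add; simpl; ring. Qed.

Lemma psum_incr (a : nat -> R) :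
  (forall k, (1 <= k)%nat -> 0 <= a k) ->
  forall m n, (m <= n)%nat -> psum a m <= psum a n.
Proof.
intros H m n Hmn; replace n with (m + (n - m))%nat by lia.
rewrite psum_add.
enough (0 <= psum (fun k => a (m + k)%nat) (n - m)) by lra.
apply psum_nonneg; intros; apply H; lia.
Qed.

(** * Partial fractions of 1 / (exp y - 1) *)

(** The mean value theorem in the form used for almost every inequality between functions below: the
    two sides are brought into one difference whose derivative has a sign. *)
Lemma derive_nonneg_le (f df : R -> R) (a b : R) :
  a <= b -> (forall x, a <= x <= b -> is_derive f x (df x)) ->
  (forall x, a <= x <= b -> 0 <= df x) -> f a <= f b.
Proof.
intros Hab Hd Hp.
destruct (MVT_gen f a b df) as [c [Hc E]].
- rewrite Rmin_left, Rmax_right by lra; intros; apply Hd; lra.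
- rewrite Rmin_left, Rmax_right by lra; intros.
  apply continuity_pt_filterlim; apply (ex_derive_continuous f x).
  eexists; apply Hd; lra.
- rewrite Rmin_left, Rmax_right in Hc by lra.
  specialize (Hp c Hc); nra.
Qed.

(** * Taylor bounds for sin, cos, sinh and cosh *)

(** Start of a chain: each of the next three bounds has the previous one as the sign of its
    derivative. *)
Lemma sin_le_id (x : R) : 0 <= x -> sin x <= x.
Proof.
intros Hx.
enough (0 - sin 0 <= x - sin x) by (rewrite sin_0 in *; lra).
apply (derive_nonneg_le (fun t => t - sin t) (fun t => 1 - cos t)); [lra| |].
- intros t _; auto_derive; [easy|ring].
- intros t _; destruct (COS_bound t); lra.
Qed.

Lemma cos_ge_quadratic (x : R) : 0 <= x -> 1 - x ^ 2 / 2 <= cos x.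
Proof.
intros Hx.
enough (cos 0 - 1 + 0 ^ 2 / 2 <= cos x - 1 + x ^ 2 / 2) by (rewrite cos_0 in *; lra).
apply (derive_nonneg_le (fun t => cos t - 1 + t ^ 2 / 2) (fun t => t - sin t)); [lra| |].
- intros t _; auto_derive; [easy|field].
- intros t Ht; assert (H := sin_le_id t ltac:(lra)); lra.
Qed.

Lemma sin_ge_cubic (x : R) : 0 <= x -> x - x ^ 3 / 6 <= sin x.
Proof.
intros Hx.
enough (sin 0 - 0 + 0 ^ 3 / 6 <= sin x - x + x ^ 3 / 6) by (rewrite sin_0 in *; lra).
apply (derive_nonneg_le (fun t => sin t - t + t ^ 3 / 6) (fun t => cos t - 1 + t ^ 2 / 2)); [lra| |].
- intros t _; auto_derive; [easy|field].
- intros t Ht; assert (H := cos_ge_quadratic t ltac:(lra)); lra.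
Qed.

Lemma cos_le_quartic (x : R) : 0 <= x -> cos x <= 1 - x ^ 2 / 2 + x ^ 4 / 24.
Proof.
intros Hx.
enough (1 - 0 ^ 2 / 2 + 0 ^ 4 / 24 - cos 0 <= 1 - x ^ 2 / 2 + x ^ 4 / 24 - cos x) by (rewrite cos_0 in *; lra).
apply (derive_nonneg_le (fun t => 1 - t ^ 2 / 2 + t ^ 4 / 24 - cos t) (fun t => sin t - t + t ^ 3 / 6)); [lra| |].
- intros t _; auto_derive; [easy|field].
- intros t Ht; assert (H := sin_ge_cubic t ltac:(lra)); lra.
Qed.

Lemma cos_taylor (t : R) : 1 - t ^ 2 / 2 <= cos t <= 1 - t ^ 2 / 2 + t ^ 4 / 24.
Proof.
destruct (Rle_dec 0 t) as [H|H].
- split; [apply cos_ge_quadratic|apply cos_le_quartic]; lra.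
- rewrite <- (cos_neg t); replace (t ^ 2) with ((- t) ^ 2) by ring;
    replace (t ^ 4) with ((- t) ^ 4) by ring.
  split; [apply cos_ge_quadratic|apply cos_le_quartic]; lra.
Qed.

(** The left side comes from 1 - cos t = 2 sin(t/2)^2. As PI <= 4, the half angle x = |t|/2 is at
    most 2, so x - x^3/6 >= x/3, and 2 (|t|/6)^2 = t^2/18. *)
Lemma one_minus_cos_ge (t : R) : Rabs t <= PI -> t ^ 2 / 18 <= 1 - cos t.
Proof.
intros Ht; assert (P4 := PI_4).
assert (E : 1 - cos t = 2 * sin (Rabs t / 2) ^ 2).
{
  assert (E : cos t = cos (Rabs t)).
  { unfold Rabs; destruct (Rcase_abs t); [now rewrite cos_neg|reflexivity]. }
  rewrite E; replace (Rabs t) with (2 * (Rabs t / 2)) at 1 by field.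
  rewrite cos_2a_sin; ring. }
rewrite E; rewrite <- (pow2_abs t).
assert (Hp := Rabs_pos t).
assert (Hs := sin_ge_cubic (Rabs t / 2) ltac:(lra)).
assert (Rabs t / 2 / 3 <= sin (Rabs t / 2)) by nra.
nra.
Qed.

(** The crude bound (e + 1)/2 <= 2. Integrated four times, it yields the upper bounds on [0,1]
    below, with remainders twice the next Taylor term. *)
Lemma cosh_le_2 (y : R) : 0 <= y <= 1 -> cosh y <= 2.
Proof.
intros Hy; unfold cosh.
assert (exp y <= exp 1) by (destruct (proj2 Hy); [left; apply exp_increasing; lra|subst; lra]).
assert (exp (- y) <= exp 0) by (destruct (proj1 Hy); [left; apply exp_increasing; lra|subst; rewrite Ropp_0; lra]).
assert (H3 := exp_le_3); rewrite exp_0 in *; lra.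
Qed.

Lemma is_derive_sinh (y : R) : is_derive sinh y (cosh y).
Proof. unfold sinh, cosh; auto_derive; [easy|field]. Qed.

Lemma is_derive_cosh (y : R) : is_derive cosh y (sinh y).
Proof. unfold sinh, cosh; auto_derive; [easy|field]. Qed.

Lemma sinh_nonneg (y : R) : 0 <= y -> 0 <= sinh y.
Proof.
intros Hy; unfold sinh.
enough (exp (- y) <= exp y) by lra.
destruct Hy; [left; apply exp_increasing; lra|subst; rewrite Ropp_0; lra].
Qed.

Lemma cosh_ge_1 (y : R) : 0 <= y -> 1 <= cosh y.
Proof.
intros Hy; rewrite <- cosh_0; apply (derive_nonneg_le cosh sinh); [lra| |].
- intros; apply is_derive_cosh.
- intros; apply sinh_nonneg; lra.
Qed.

Lemma sinh_taylor1 (y : R) : 0 <= y <= 1 -> y <= sinh y <= 2 * y.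
Proof.
intros Hy; split.
- enough (sinh 0 - 0 <= sinh y - y) by (rewrite sinh_0 in *; lra).
  apply (derive_nonneg_le (fun t => sinh t - t) (fun t => cosh t - 1)); [lra| |].
  + intros t _; apply (is_derive_minus sinh (fun t => t)); [apply is_derive_sinh|apply (is_derive_id t)].
  + intros t Ht; assert (H := cosh_ge_1 t ltac:(lra)); lra.
- enough (2 * 0 - sinh 0 <= 2 * y - sinh y) by (rewrite sinh_0 in *; lra).
  apply (derive_nonneg_le (fun t => 2 * t - sinh t) (fun t => 2 - cosh t)); [lra| |].
  + intros t _; apply (is_derive_minus (fun t => 2 * t) sinh); [auto_derive; [easy|ring]|apply is_derive_sinh].
  + intros t Ht; assert (H := cosh_le_2 t ltac:(lra)); lra.
Qed.

Lemma cosh_taylor2 (y : R) : 0 <= y <= 1 -> y ^ 2 / 2 <= cosh y - 1 <= y ^ 2.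
Proof.
intros Hy; split.
- enough (cosh 0 - 0 ^ 2 / 2 <= cosh y - y ^ 2 / 2) by (rewrite cosh_0 in *; lra).
  apply (derive_nonneg_le (fun t => cosh t - t ^ 2 / 2) (fun t => sinh t - t)); [lra| |].
  + intros t _; apply (is_derive_minus cosh (fun t => t ^ 2 / 2)); [apply is_derive_cosh|auto_derive; [easy|field]].
  + intros t Ht; assert (H := sinh_taylor1 t ltac:(lra)); lra.
- enough (0 ^ 2 - cosh 0 <= y ^ 2 - cosh y) by (rewrite cosh_0 in *; lra).
  apply (derive_nonneg_le (fun t => t ^ 2 - cosh t) (fun t => 2 * t - sinh t)); [lra| |].
  + intros t _; apply (is_derive_minus (fun t => t ^ 2) cosh); [auto_derive; [easy|ring]|apply is_derive_cosh].
  + intros t Ht; assert (H := sinh_taylor1 t ltac:(lra)); lra.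
Qed.

Lemma sinh_taylor3 (y : R) : 0 <= y <= 1 -> 0 <= sinh y - y <= y ^ 3 / 3.
Proof.
intros Hy; split; [assert (H := sinh_taylor1 y Hy); lra|].
enough (0 ^ 3 / 3 + 0 - sinh 0 <= y ^ 3 / 3 + y - sinh y) by (rewrite sinh_0 in *; lra).
apply (derive_nonneg_le (fun t => t ^ 3 / 3 + t - sinh t) (fun t => t ^ 2 + 1 - cosh t)); [lra| |].
- intros t _; apply (is_derive_minus (fun t => t ^ 3 / 3 + t) sinh); [auto_derive; [easy|field]|apply is_derive_sinh].
- intros t Ht; assert (H := cosh_taylor2 t ltac:(lra)); lra.
Qed.

Lemma cosh_taylor4 (y : R) : 0 <= y <= 1 -> 0 <= cosh y - 1 - y ^ 2 / 2 <= y ^ 4 / 12.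
Proof.
intros Hy; split; [assert (H := cosh_taylor2 y Hy); lra|].
enough (0 ^ 4 / 12 + 0 ^ 2 / 2 - cosh 0 <= y ^ 4 / 12 + y ^ 2 / 2 - cosh y) by (rewrite cosh_0 in *; lra).
apply (derive_nonneg_le (fun t => t ^ 4 / 12 + t ^ 2 / 2 - cosh t) (fun t => t ^ 3 / 3 + t - sinh t)); [lra| |].
- intros t _; apply (is_derive_minus (fun t => t ^ 4 / 12 + t ^ 2 / 2) cosh); [auto_derive; [easy|field]|apply is_derive_cosh].
- intros t Ht; assert (H := sinh_taylor3 t ltac:(lra)); lra.
Qed.

(** * The Poisson kernel and its duplication *)

(** The Poisson kernel of the unit disc, Re((1 + z)/(1 - z)), at z = exp(-y + i th). *)
Definition poisson_kernel (y th : R) : R := sinh y / (cosh y - cos th).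

Lemma cosh_gt_1 (y : R) : 0 < y -> 1 < cosh y.
Proof.
intros Hy.
assert (E : exp y * exp (- y) = 1) by (rewrite <- exp_plus, Rplus_opp_r; apply exp_0).
assert (H := exp_ineq1 y ltac:(lra)); assert (P := exp_pos (- y)).
unfold cosh; nra.
Qed.

(** With z = w^2, (1 + w^2)/(1 - w^2) is the mean of (1 + w)/(1 - w) and (1 - w)/(1 + w), so the
    kernel at z is the mean over the two square roots of z. *)
Lemma poisson_kernel_half (y th : R) : 0 < y ->
  poisson_kernel y th =
  (poisson_kernel (y / 2) (th / 2) + poisson_kernel (y / 2) (th / 2 + PI)) / 2.
Proof.
intros Hy; unfold poisson_kernel; rewrite neg_cos.
assert (Hc := cosh_gt_1 (y / 2) ltac:(lra)).
assert (Hb := COS_bound (th / 2)).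
assert (E1 : sinh y = 2 * sinh (y / 2) * cosh (y / 2)).
{ unfold sinh, cosh; replace y with (y / 2 + y / 2) at 1 2 by field.
  rewrite Ropp_plus_distr, !exp_plus; field. }
assert (E2 : cosh y = 2 * cosh (y / 2) ^ 2 - 1).
{ unfold sinh, cosh; replace y with (y / 2 + y / 2) at 1 2 by field.
  rewrite Ropp_plus_distr, !exp_plus.
  assert (E : exp (y / 2) * exp (- (y / 2)) = 1) by (rewrite <- exp_plus, Rplus_opp_r; apply exp_0).
  replace (2 * ((exp (y / 2) + exp (- (y / 2))) / 2) ^ 2 - 1) with
    ((exp (y / 2) ^ 2 + exp (- (y / 2)) ^ 2) / 2 + (exp (y / 2) * exp (- (y / 2)) - 1)) by field.
  rewrite E; field. }
assert (E3 : cos th = 2 * cos (th / 2) ^ 2 - 1).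
{ replace th with (2 * (th / 2)) at 1 by field; rewrite cos_2a_cos; ring. }
rewrite E1, E2, E3; field; repeat split; nra.
Qed.

Lemma poisson_kernel_iter (n : nat) (y th : R) : 0 < y ->
  poisson_kernel y th =
  / 2 ^ n * psum (fun j => poisson_kernel (y / 2 ^ n) ((th + 2 * PI * INR j) / 2 ^ n)) (2 ^ n).
Proof.
intros Hy; induction n as [|n IH].
- simpl; unfold poisson_kernel.
  (* The only index is j = 1, so the angle is moved by one full period. *)
  replace ((th + 2 * PI * 1) / 1) with (th + 2 * INR 1 * PI) by (simpl INR; field).
  rewrite cos_period, Rdiv_1_r; field.
  assert (H := cosh_gt_1 y Hy); assert (Hb := COS_bound th); lra.
- rewrite IH.
  assert (P : 0 < 2 ^ n) by (apply pow_lt; lra).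
  (* At the new stage, index 2^n + j has the angle of index j plus PI, which is the second square
     root. *)
  replace (2 ^ S n)%nat with (2 ^ n + 2 ^ n)%nat by (simpl; lia).
  rewrite psum_add, <- psum_plus, <- !psum_scal.
  apply psum_ext; intros j _.
  rewrite poisson_kernel_half by (apply Rdiv_lt_0_compat; lra).
  replace (y / 2 ^ n / 2) with (y / 2 ^ S n) by (simpl; field; lra).
  replace ((th + 2 * PI * INR j) / 2 ^ n / 2) with ((th + 2 * PI * INR j) / 2 ^ S n) by (simpl; field; lra).
  replace ((th + 2 * PI * INR (2 ^ n + j)) / 2 ^ S n) with ((th + 2 * PI * INR j) / 2 ^ S n + PI).
  + simpl; field; lra.
  + rewrite plus_INR, pow_INR; simpl; change (1 + 1) with 2; field; lra.
Qed.

(* At the 2^n-th stage of [poisson_kernel_iter] these errors are O(y / 2^n) each and are averaged,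
   so no tail estimate is needed. *)
Lemma poisson_kernel_approx (y th : R) : 0 < y <= 1 -> Rabs th <= PI ->
  Rabs (poisson_kernel y th - 2 * y / (y ^ 2 + th ^ 2)) <= 36 * y.
Proof.
intros Hy Ht.
assert (H1 := one_minus_cos_ge th Ht); assert (H2 := cos_taylor th).
assert (H3 := sinh_taylor3 y ltac:(lra)); assert (H4 := cosh_taylor4 y ltac:(lra)).
set (q := y ^ 2 + th ^ 2).
assert (Q : 0 < q) by (unfold q; nra).
assert (D : q / 18 <= cosh y - cos th) by (unfold q; nra).
(* The leading terms y of sinh y and q/2 of cosh y - cos th cancel, so only Taylor remainders are
   left. Division by [D] turns the factor 2 into 36 = 2 * 18. *)
assert (N : Rabs (sinh y * q - 2 * y * (cosh y - cos th)) <= 2 * y * q ^ 2).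
{ replace (sinh y * q - 2 * y * (cosh y - cos th)) with
    ((sinh y - y) * q - 2 * y * (cosh y - 1 - y ^ 2 / 2) + 2 * y * (cos th - 1 + th ^ 2 / 2))
    by (unfold q; field).
  assert (A1 : 0 <= (sinh y - y) * q <= y ^ 3 / 3 * q) by (split; nra).
  assert (A2 : 0 <= 2 * y * (cosh y - 1 - y ^ 2 / 2) <= 2 * y * (y ^ 4 / 12)) by (split; nra).
  assert (A3 : 0 <= 2 * y * (cos th - 1 + th ^ 2 / 2) <= 2 * y * (th ^ 4 / 24)) by (split; nra).
  assert (A4 : y ^ 3 / 3 * q <= y / 3 * q ^ 2).
  { replace (y / 3 * q ^ 2) with (y / 3 * q * (y ^ 2 + th ^ 2)) by (unfold q; ring).
    replace (y ^ 3 / 3 * q) with (y / 3 * q * y ^ 2) by field.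
    apply Rmult_le_compat_l; nra. }
  assert (A5 : y ^ 4 <= q ^ 2) by (unfold q; nra).
  assert (A6 : th ^ 4 <= q ^ 2) by (unfold q; nra).
  assert (A7 : 2 * y * (y ^ 4 / 12) <= 2 * y * (q ^ 2 / 12)) by nra.
  assert (A8 : 2 * y * (th ^ 4 / 24) <= 2 * y * (q ^ 2 / 24)) by nra.
  assert (0 <= y * q ^ 2) by nra.
  apply Rabs_le; split; lra. }
unfold poisson_kernel.
replace (sinh y / (cosh y - cos th) - 2 * y / q) with
  ((sinh y * q - 2 * y * (cosh y - cos th)) / ((cosh y - cos th) * q)) by (field; lra).
unfold Rdiv; rewrite Rabs_mult, Rabs_inv, (Rabs_pos_eq ((cosh y - cos th) * q)) by nra.
apply Rmult_le_reg_r with ((cosh y - cos th) * q); [nra|].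
rewrite Rmult_assoc, Rinv_l, Rmult_1_r by nra.
eapply Rle_trans; [exact N|].
replace (2 * y * q ^ 2) with (36 * y * (q / 18 * q)) by field.
apply Rmult_le_compat_l; [lra|apply Rmult_le_compat_r; lra].
Qed.

(** The arguments run over 1 - N, ..., N: of the two extreme terms only the one at N occurs, hence
    the subtraction. *)
Lemma psum_symmetric (g : R -> R) (N : nat) : (forall x, g (- x) = g x) ->
  psum (fun j => g (INR j - INR N)) (2 * N) =
  g 0 + 2 * psum (fun j => g (INR j)) N - g (INR N).
Proof.
intros Hg; induction N as [|N IH]; [simpl; ring|].
replace (2 * S N)%nat with (S (S (2 * N))) by lia.
rewrite psum_shift.
rewrite (psum_ext (fun k => g (INR (S k) - INR (S N))) (fun k => g (INR k - INR N))).
2:{ intros k _; f_equal; rewrite !S_INR; ring. }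
cbn [psum]; rewrite IH.
replace (INR 1 - INR (S N)) with (- INR N) by (rewrite (S_INR N); simpl; ring).
rewrite Hg.
replace (INR (S (2 * N)) - INR N) with (INR (S N)) by (rewrite !S_INR, mult_INR; simpl; ring).
ring.
Qed.

(** Both sides are coth(y/2). *)
Lemma poisson_kernel_0 (y : R) : 0 < y -> poisson_kernel y 0 = 1 + 2 / (exp y - 1).
Proof.
intros Hy; unfold poisson_kernel, sinh, cosh; rewrite cos_0, exp_Ropp.
assert (H := exp_ineq1 y ltac:(lra)); field; repeat split; nra.
Qed.

Lemma coth_partial_fractions_bound (m : nat) (y : R) : 0 < y <= 2 ^ S m ->
  Rabs (poisson_kernel y 0 -
        psum (fun j => 2 * y / (y ^ 2 + (2 * PI * (INR j - INR (2 ^ m))) ^ 2)) (2 * 2 ^ m))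
  <= 36 * (y / 2 ^ S m).
Proof.
intros Hy.
assert (P : 0 < 2 ^ S m) by (apply pow_lt; lra).
assert (Pi := PI_RGT_0).
(* Shifting by whole periods centres the 2^(m+1) angles at 0; they then lie in [-PI, PI], where
   [poisson_kernel_approx] applies. *)
assert (E0 : poisson_kernel y 0 = poisson_kernel y (- (2 * PI * INR (2 ^ m)))).
{ unfold poisson_kernel; rewrite <- (cos_period (- _) (2 ^ m)); do 3 f_equal; ring. }
rewrite E0, (poisson_kernel_iter (S m)) by lra.
change (2 ^ S m)%nat with (2 * 2 ^ m)%nat.
rewrite <- psum_scal, <- psum_minus.
eapply Rle_trans; [apply psum_abs|].
apply Rle_trans with (psum (fun _ => / 2 ^ S m * (36 * (y / 2 ^ S m))) (2 * 2 ^ m)).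
2:{ rewrite psum_const; right; change (2 * 2 ^ m)%nat with (2 ^ S m)%nat; rewrite pow_INR.
    change (INR 2) with 2; field; lra. }
apply psum_le; intros j Hj.
set (th := (- (2 * PI * INR (2 ^ m)) + 2 * PI * INR j) / 2 ^ S m).
replace (2 * y / (y ^ 2 + (2 * PI * (INR j - INR (2 ^ m))) ^ 2))
  with (/ 2 ^ S m * (2 * (y / 2 ^ S m) / ((y / 2 ^ S m) ^ 2 + th ^ 2))).
2:{ set (D := 2 * PI * (INR j - INR (2 ^ m))).
    replace th with (D / 2 ^ S m) by (unfold th, D; field; lra).
    assert (0 < y ^ 2 + D ^ 2) by nra.
    field; lra. }
rewrite <- Rmult_minus_distr_l, Rabs_mult, Rabs_pos_eq by (left; apply Rinv_0_lt_compat; lra).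
apply Rmult_le_compat_l; [left; apply Rinv_0_lt_compat; lra|].
apply poisson_kernel_approx.
- split; [apply Rdiv_lt_0_compat; lra|].
  apply Rmult_le_reg_r with (2 ^ S m); [lra|]; unfold Rdiv; rewrite Rmult_assoc, Rinv_l; lra.
- assert (E : 2 ^ S m = 2 * INR (2 ^ m)) by (rewrite pow_INR; reflexivity).
  assert (J : INR j <= 2 * INR (2 ^ m)) by (rewrite <- (mult_INR 2); apply le_INR; lia).
  assert (J0 := pos_INR j).
  replace th with (PI * ((INR j - INR (2 ^ m)) / INR (2 ^ m))) by (unfold th; rewrite E; field; lra).
  assert (B : Rabs ((INR j - INR (2 ^ m)) / INR (2 ^ m)) <= 1).
  { unfold Rdiv; rewrite Rabs_mult, Rabs_inv, (Rabs_pos_eq (INR (2 ^ m))) by lra.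
    apply Rmult_le_reg_r with (INR (2 ^ m)); [lra|].
    rewrite Rmult_assoc, Rinv_l by lra; rewrite Rmult_1_r, Rmult_1_l; apply Rabs_le; lra. }
  rewrite Rabs_mult, (Rabs_pos_eq PI) by lra; nra.
Qed.

Lemma is_lim_seq_pow2_inv : is_lim_seq (fun m => / 2 ^ m) 0.
Proof.
apply is_lim_seq_ext with (fun m => (/ 2) ^ m).
- intros m; apply pow_inv.
- apply is_lim_seq_geom; rewrite Rabs_pos_eq; lra.
Qed.

Lemma filterlim_pow2 : filterlim (fun m => (2 ^ m)%nat) eventually eventually.
Proof. apply eventually_subseq; intros n; simpl; assert (H := Nat.pow_nonzero 2 n); lia. Qed.

(** Increasing partial sums have a limit, so one subsequence determines it. It is needed because
    duplication controls only the partial sums of length 2^m. *)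
Lemma psum_lim_of_subseq (a : nat -> R) (phi : nat -> nat) (l : R) :
  (forall k, (1 <= k)%nat -> 0 <= a k) -> filterlim phi eventually eventually ->
  is_lim_seq (fun n => psum a (phi n)) l -> is_lim_seq (psum a) l.
Proof.
intros Ha Hphi Hl.
assert (Ex : ex_lim_seq (psum a)).
{ apply ex_lim_seq_incr; intros n; apply psum_incr; [exact Ha|lia]. }
destruct Ex as [l' Hl'].
assert (H := is_lim_seq_subseq _ _ _ Hphi Hl').
replace (Finite l) with l'; [exact Hl'|].
apply is_lim_seq_unique in H; apply is_lim_seq_unique in Hl; congruence.
Qed.

(** Euler's expansion of coth: in the symmetric sum the index 0 contributes 2/y, and the remaining
    terms pair up. *)
Lemma coth_partial_fractions (y : R) : 0 < y ->
  is_lim_seq (psum (fun m => 2 * y / (y ^ 2 + (2 * PI * INR m) ^ 2)))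
    (/ (exp y - 1) - / y + / 2).
Proof.
intros Hy; assert (Pi := PI_RGT_0).
assert (Pos : forall m, 0 < y ^ 2 + (2 * PI * INR m) ^ 2).
{ intros m; assert (0 < y ^ 2) by nra; assert (H0 := pow2_ge_0 (2 * PI * INR m)); lra. }
apply psum_lim_of_subseq with (fun m => (2 ^ m)%nat).
- intros k _; specialize (Pos k); left; apply Rdiv_lt_0_compat; lra.
- exact filterlim_pow2.
- set (a := fun m : nat => 2 * y / (y ^ 2 + (2 * PI * INR m) ^ 2)).
  set (l := / (exp y - 1) - / y + / 2).
  (* Half of the kernel error 18 y / 2^m, plus half of the unpaired extreme term, which is at most 2
     y / 2^m. *)
  assert (Main : forall m, y <= 2 ^ S m ->
    Rabs (psum a (2 ^ m) - l) <= 9 * y * / 2 ^ m + y * (/ 2 ^ m)).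
  { intros m Hm.
    assert (H := coth_partial_fractions_bound m y (conj Hy Hm)).
    rewrite (psum_symmetric (fun t => 2 * y / (y ^ 2 + (2 * PI * t) ^ 2))) in H
      by (intros; do 2 f_equal; ring).
    rewrite poisson_kernel_0 in H by lra.
    fold a in H.
    assert (P : 1 <= 2 ^ m) by (apply pow_R1_Rle; lra).
    assert (E : INR (2 ^ m) = 2 ^ m) by (rewrite pow_INR; reflexivity).
    assert (Small : 0 <= 2 * y / (y ^ 2 + (2 * PI * INR (2 ^ m)) ^ 2) <= 2 * y * / 2 ^ m).
    { specialize (Pos (2 ^ m)%nat); split; [left; apply Rdiv_lt_0_compat; lra|].
      apply Rmult_le_compat_l; [lra|]; apply Rinv_le_contravar; [lra|].
      rewrite E; assert (H2 := PI2_1); assert (4 <= 2 * PI) by lra;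
      assert (2 ^ m <= 2 * PI * 2 ^ m) by nra; assert (0 <= y ^ 2) by nra; nra. }
    replace (2 * y / (y ^ 2 + (2 * PI * 0) ^ 2)) with (2 / y) in H by (field; lra).
    replace (36 * (y / 2 ^ S m)) with (18 * y * / 2 ^ m) in H by (simpl; field; lra).
    assert (L : 2 * l = 1 + 2 / (exp y - 1) - 2 / y).
    { unfold l; field; assert (H3 := exp_ineq1 y ltac:(lra)); lra. }
    apply Rabs_le; apply Rabs_le_between in H; lra. }
  apply is_lim_seq_ext_loc with (fun m => l + (psum a (2 ^ m) - l)).
  { exists O; intros; ring. }
  replace (Finite l) with (Rbar_plus l 0) by (simpl; f_equal; ring).
  apply is_lim_seq_plus'; [apply is_lim_seq_const|].
  apply is_lim_seq_abs_0.
  apply is_lim_seq_le_le_loc with (fun _ => 0) (fun m => 9 * y * / 2 ^ m + y * / 2 ^ m).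
  + destruct (nfloor_ex y ltac:(lra)) as [n Hn]; exists n; intros m Hm.
    split; [apply Rabs_pos|apply Main].
    assert (INR m < 2 ^ m).
    { clear; induction m as [|m IH]; [simpl; lra|].
      rewrite S_INR; simpl; assert (1 <= 2 ^ m) by (apply pow_R1_Rle; lra); lra. }
    assert (INR n <= INR m) by (apply le_INR; lia).
    assert (1 <= 2 ^ m) by (apply pow_R1_Rle; lra).
    simpl; lra.
  + apply is_lim_seq_const.
  + replace (Finite 0) with (Finite (9 * y * 0 + y * 0)) by (f_equal; ring).
    apply is_lim_seq_plus'; apply is_lim_seq_mult'; first [apply is_lim_seq_const|apply is_lim_seq_pow2_inv].
Qed.

(** * The Euler product as a Lambert series *)

Lemma is_lim_seq_le_const (u : nat -> R) (l c : R) :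
  is_lim_seq u l -> (forall n, u n <= c) -> l <= c.
Proof. intros H Hc; exact (is_lim_seq_le u (fun _ => c) l c Hc H (is_lim_seq_const c)). Qed.

Lemma psum_le_lim (a : nat -> R) (l : R) (N : nat) :
  (forall k, (1 <= k)%nat -> 0 <= a k) -> is_lim_seq (psum a) l -> psum a N <= l.
Proof. intros Ha Hl; apply (is_lim_seq_incr_compare (psum a) l Hl); intros n; apply psum_incr; [exact Ha|lia]. Qed.

Lemma psum_bounded_lim (a : nat -> R) (c : R) :
  (forall k, (1 <= k)%nat -> 0 <= a k) -> (forall n, psum a n <= c) ->
  exists l : R, is_lim_seq (psum a) l.
Proof.
intros Ha Hc; destruct (ex_finite_lim_seq_incr (psum a) c) as [l Hl].
- intros n; apply psum_incr; [exact Ha|lia].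
- exact Hc.
- now exists l.
Qed.

Lemma is_lim_seq_psum (u : nat -> nat -> R) (l : nat -> R) (K : nat) :
  (forall k, (1 <= k)%nat -> is_lim_seq (fun n => u n k) (l k)) ->
  is_lim_seq (fun n => psum (u n) K) (psum l K).
Proof.
intros H; induction K as [|K IH]; simpl; [apply is_lim_seq_const|].
apply is_lim_seq_plus'; [exact IH|apply H; lia].
Qed.

(** Tonelli for nonnegative terms: every finite rectangle is bounded by either iterated sum, which
    gives both inequalities between the two limits. *)
Lemma double_series_exchange (a : nat -> nat -> R) (r c : nat -> R) (L : R) :
  (forall n k, (1 <= n)%nat -> (1 <= k)%nat -> 0 <= a n k) ->
  (forall n, (1 <= n)%nat -> is_lim_seq (psum (a n)) (r n)) ->
  (forall k, (1 <= k)%nat -> is_lim_seq (psum (fun n => a n k)) (c k)) ->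
  is_lim_seq (psum r) L -> is_lim_seq (psum c) L.
Proof.
intros Ha Hr Hc HL.
assert (r0 : forall n, (1 <= n)%nat -> 0 <= r n).
{ intros n Hn; apply Rle_trans with (psum (a n) 0); [simpl; lra|apply psum_le_lim; auto]. }
assert (c0 : forall k, (1 <= k)%nat -> 0 <= c k).
{ intros k Hk; apply Rle_trans with (psum (fun n => a n k) 0); [simpl; lra|].
  apply psum_le_lim; auto. }
assert (Up : forall K, psum c K <= L).
{ intros K; apply is_lim_seq_le_const with (fun N => psum (fun k => psum (fun n => a n k) N) K).
  - apply is_lim_seq_psum; exact Hc.
  - intros N; rewrite <- psum_exchange.
    apply Rle_trans with (psum r N); [|apply psum_le_lim; auto].
    apply psum_le; intros n Hn; apply psum_le_lim; [intros; apply Ha; lia|apply Hr; lia]. }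
destruct (psum_bounded_lim c L c0 Up) as [l Hl].
assert (l <= L) by (apply is_lim_seq_le_const with (psum c); assumption).
assert (L <= l).
{ apply is_lim_seq_le_const with (psum r); [exact HL|]; intros N.
  apply is_lim_seq_le_const with (fun K => psum (fun n => psum (a n) K) N).
  - apply is_lim_seq_psum; exact Hr.
  - intros K; rewrite psum_exchange.
    apply Rle_trans with (psum c K); [|apply psum_le_lim; auto].
    apply psum_le; intros k Hk; apply psum_le_lim; [intros; apply Ha; lia|apply Hc; lia]. }
replace L with l by lra; exact Hl.
Qed.

Lemma psum_geom (x : R) (K : nat) : x <> 1 ->
  psum (fun k => x ^ (k - 1)) K = (1 - x ^ K) / (1 - x).
Proof.
intros Hx; induction K as [|K IH]; [simpl; field; lra|].
cbn [psum]; rewrite IH; replace (S K - 1)%nat with K by lia; simpl; field; lra.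
Qed.

Lemma is_lim_seq_geom_from_1 (q : R) : 0 <= q < 1 ->
  is_lim_seq (psum (fun k => q ^ k)) (q / (1 - q)).
Proof.
intros Hq; apply is_lim_seq_ext with (fun K => q / (1 - q) * (1 - q ^ K)).
- intros K; rewrite (psum_ext _ (fun k => q * q ^ (k - 1))).
  + rewrite psum_scal, psum_geom by lra; field; lra.
  + intros k Hk; rewrite tech_pow_Rmult; f_equal; lia.
- replace (Finite (q / (1 - q))) with (Finite (q / (1 - q) * (1 - 0))) by (f_equal; ring).
  apply is_lim_seq_mult'; [apply is_lim_seq_const|].
  apply is_lim_seq_minus'; [apply is_lim_seq_const|].
  apply is_lim_seq_geom; rewrite Rabs_pos_eq; lra.
Qed.

Lemma is_derive_log_partial (x : R) (K : nat) :
  is_derive (fun t => psum (fun k => t ^ k / INR k) K) x (psum (fun k => x ^ (k - 1)) K).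
Proof.
induction K as [|K IH]; cbn [psum]; [apply (is_derive_const 0 x)|].
apply (is_derive_plus (fun t => psum (fun k => t ^ k / INR k) K) (fun t => t ^ S K / INR (S K))); [exact IH|].
assert (INR (S K) <> 0) by (apply not_0_INR; lia).
auto_derive; [easy|]; replace (S K - 1)%nat with K by lia; simpl pred; field; assumption.
Qed.

(** The remainder after K terms has derivative t^K / (1 - t), which on [0,q] lies between 0 and its
    value at q; hence it is at most q times that value. *)
Lemma log_series (q : R) : 0 <= q < 1 ->
  is_lim_seq (psum (fun k => q ^ k / INR k)) (- ln (1 - q)).
Proof.
intros Hq.
set (g := fun K t => - ln (1 - t) - psum (fun k => t ^ k / INR k) K).
assert (g0 : forall K, g K 0 = 0).
{ intros K; unfold g; rewrite Rminus_0_r, ln_1, (psum_ext _ (fun _ => 0)).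
  - rewrite psum_const; ring.
  - intros k Hk; rewrite pow_i by lia; unfold Rdiv; ring. }
assert (Dg : forall K t, 0 <= t <= q -> is_derive (g K) t (t ^ K / (1 - t))).
{ intros K t Ht.
  replace (t ^ K / (1 - t)) with (/ (1 - t) - psum (fun k => t ^ (k - 1)) K)
    by (rewrite psum_geom by lra; field; lra).
  apply (is_derive_minus (fun t => - ln (1 - t)) (fun t => psum (fun k => t ^ k / INR k) K)).
  - auto_derive; [lra|field; lra].
  - apply is_derive_log_partial. }
assert (Bd : forall K, 0 <= g K q <= q / (1 - q) * q ^ K).
{ intros K; split.
  - rewrite <- (g0 K); apply (derive_nonneg_le (g K) (fun t => t ^ K / (1 - t))); [lra|apply Dg|].
    intros t Ht; apply Rmult_le_pos; [apply pow_le; lra|left; apply Rinv_0_lt_compat; lra].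
  - enough (0 * (q ^ K / (1 - q)) - g K 0 <= q * (q ^ K / (1 - q)) - g K q).
    { rewrite g0 in *; replace (q / (1 - q) * q ^ K) with (q * (q ^ K / (1 - q))) by (field; lra); lra. }
    apply (derive_nonneg_le (fun t => t * (q ^ K / (1 - q)) - g K t)
      (fun t => q ^ K / (1 - q) - t ^ K / (1 - t))); [lra| |].
    + intros t Ht; apply (is_derive_minus (fun t => t * (q ^ K / (1 - q))) (g K)); [|apply Dg; lra].
      auto_derive; [easy|ring].
    + intros t Ht.
      enough (t ^ K / (1 - t) <= q ^ K / (1 - q)) by lra.
      apply Rmult_le_compat; [apply pow_le; lra|left; apply Rinv_0_lt_compat; lra|apply pow_incr; lra|].
      apply Rinv_le_contravar; lra. }
apply is_lim_seq_ext with (fun K => - ln (1 - q) - g K q); [intros K; unfold g; ring|].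
replace (Finite (- ln (1 - q))) with (Finite (- ln (1 - q) - 0)) by (f_equal; ring).
apply is_lim_seq_minus'; [apply is_lim_seq_const|].
apply is_lim_seq_le_le with (fun _ => 0) (fun K => q / (1 - q) * q ^ K).
- exact Bd.
- apply is_lim_seq_const.
- replace (Finite 0) with (Finite (q / (1 - q) * 0)) by (f_equal; ring).
  apply is_lim_seq_mult'; [apply is_lim_seq_const|].
  apply is_lim_seq_geom; rewrite Rabs_pos_eq; lra.
Qed.

Lemma ln_le_minus_1 (z : R) : 0 < z -> ln z <= z - 1.
Proof.
intros Hz; rewrite <- (ln_exp (z - 1)); apply ln_le; [lra|].
assert (H := exp_ineq1_le (z - 1)); lra.
Qed.

Lemma neg_ln_bounds (y : R) : 0 <= y < 1 -> y <= - ln (1 - y) <= y / (1 - y).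
Proof.
intros Hy; split.
- assert (H := ln_le_minus_1 (1 - y) ltac:(lra)); lra.
- rewrite <- ln_Rinv by lra.
  eapply Rle_trans; [apply ln_le_minus_1, Rinv_0_lt_compat; lra|].
  right; field; lra.
Qed.

Lemma exp_neg_lt_1 (s : R) : 0 < s -> 0 < exp (- s) < 1.
Proof.
intros Hs; split; [apply exp_pos|]; rewrite <- exp_0; apply exp_increasing; lra.
Qed.

Lemma exp_pow (t : R) (n : nat) : exp t ^ n = exp (INR n * t).
Proof.
induction n as [|n IH]; [simpl; rewrite Rmult_0_l, exp_0; reflexivity|].
rewrite S_INR; simpl; rewrite IH, <- exp_plus; f_equal; ring.
Qed.

Lemma pow_bounds (x : R) (n : nat) : 0 < x < 1 -> (1 <= n)%nat -> 0 < x ^ n <= x.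
Proof.
intros Hx Hn; split; [apply pow_lt; lra|].
destruct n as [|n]; [lia|]; simpl.
assert (x ^ n <= 1) by (rewrite <- (pow1 n); apply pow_incr; lra); nra.
Qed.

Lemma euler_log_lim (x : R) : 0 < x < 1 ->
  exists L : R, is_lim_seq (psum (fun n => - ln (1 - x ^ n))) L.
Proof.
intros Hx.
assert (Hn := fun n => pow_bounds x n Hx).
apply psum_bounded_lim with (/ (1 - x) * (x / (1 - x))).
- intros n H; specialize (Hn n H); assert (B := neg_ln_bounds (x ^ n) ltac:(lra)); lra.
- intros N; apply Rle_trans with (/ (1 - x) * psum (fun n => x ^ n) N).
  + rewrite <- psum_scal; apply psum_le; intros n H; specialize (Hn n (proj1 H)).
    assert (B := neg_ln_bounds (x ^ n) ltac:(lra)).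
    eapply Rle_trans; [apply B|]; unfold Rdiv; rewrite Rmult_comm.
    apply Rmult_le_compat_r; [lra|apply Rinv_le_contravar; lra].
  + apply Rmult_le_compat_l; [left; apply Rinv_0_lt_compat; lra|].
    apply psum_le_lim; [intros k Hk; left; apply Hn; lia|apply is_lim_seq_geom_from_1; lra].
Qed.

(** Each logarithm is expanded in powers; summing over n before k leaves, for every k, a geometric
    series of ratio x^k. *)
Lemma euler_log_lambert (s L : R) : 0 < s ->
  is_lim_seq (psum (fun n => - ln (1 - exp (- s) ^ n))) L ->
  is_lim_seq (psum (fun k => / (INR k * (exp (INR k * s) - 1)))) L.
Proof.
intros Hs; assert (Hx := exp_neg_lt_1 s Hs); set (x := exp (- s)) in *.
assert (Hn : forall n, (1 <= n)%nat -> 0 < x ^ n < 1).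
{ intros n H; assert (B := pow_bounds x n Hx H); lra. }
apply double_series_exchange with (a := fun n k => (x ^ n) ^ k / INR k).
- intros n k H1 H2; apply Rmult_le_pos; [apply pow_le; apply Rlt_le, Hn, H1|].
  left; apply Rinv_0_lt_compat; apply lt_0_INR; lia.
- intros n H; apply log_series; specialize (Hn n H); lra.
- intros k Hk.
  assert (K0 : 0 < INR k) by (apply lt_0_INR; lia).
  assert (E : x ^ k = / exp (INR k * s)) by (unfold x; rewrite exp_pow, <- exp_Ropp; f_equal; ring).
  specialize (Hn k Hk).
  apply is_lim_seq_ext with (fun N => / INR k * psum (fun n => (x ^ k) ^ n) N).
  + intros N; rewrite <- psum_scal; apply psum_ext; intros n _.
    rewrite <- !pow_mult, (Nat.mul_comm n); unfold Rdiv; ring.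
  + assert (Ep := exp_ineq1 (INR k * s) ltac:(nra)).
    assert (P := Rmult_lt_0_compat _ _ K0 Hs).
    replace (/ (INR k * (exp (INR k * s) - 1))) with (/ INR k * (x ^ k / (1 - x ^ k)))
      by (rewrite E; field; repeat split; lra).
    apply is_lim_seq_mult'; [apply is_lim_seq_const|apply is_lim_seq_geom_from_1; lra].
Qed.

(** * The Basel sum *)

(** What 1/(e^y - 1) leaves after removal of its polar part 1/y - 1/2, that is coth(y/2)/2 - 1/y. It
    is the sum of the partial fractions. *)
Definition lambert_remainder (y : R) : R := / (exp y - 1) - / y + / 2.

(** The poles at 0 cancel in this combination. The right side is tanh(y/4)/4, whose behaviour near 0
    is explicit. *)
Lemma lambert_remainder_half (y : R) : 0 < y ->
  lambert_remainder y - lambert_remainder (y / 2) / 2 =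
  (exp (y / 2) - 1) / (4 * (exp (y / 2) + 1)).
Proof.
intros Hy; unfold lambert_remainder.
replace (exp y) with (exp (y / 2) * exp (y / 2)) by (rewrite <- exp_plus; f_equal; field).
assert (H := exp_ineq1 (y / 2) ltac:(lra)).
field; repeat split; nra.
Qed.

(** Termwise, 4 PI^2 / (y^2 + 4 PI^2 m^2) differs from 1/m^2 by a relative error of at most y^2,
    uniformly in m; so the bounds survive M -> infinity before y -> 0. *)
Lemma psum_inv_square_bounds (y : R) (M : nat) : 0 < y ->
  (1 - y ^ 2) * psum (fun m => / INR m ^ 2) M
  <= 2 * PI ^ 2 / y * psum (fun m => 2 * y / (y ^ 2 + (2 * PI * INR m) ^ 2)) M
  <= psum (fun m => / INR m ^ 2) M.
Proof.
intros Hy; assert (Hp := PI2_3_2).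
rewrite <- !psum_scal; split; apply psum_le; intros m Hm.
- assert (1 <= INR m) by (apply (le_INR 1); lia).
  assert (P : 0 < y ^ 2 + (2 * PI * INR m) ^ 2) by nra.
  replace (2 * PI ^ 2 / y * (2 * y / (y ^ 2 + (2 * PI * INR m) ^ 2))) with
    (4 * PI ^ 2 / (y ^ 2 + (2 * PI * INR m) ^ 2)) by (field; split; lra).
  apply Rmult_le_reg_r with (INR m ^ 2 * (y ^ 2 + (2 * PI * INR m) ^ 2)); [apply Rmult_lt_0_compat; [nra|exact P]|].
  replace ((1 - y ^ 2) * / INR m ^ 2 * (INR m ^ 2 * (y ^ 2 + (2 * PI * INR m) ^ 2)))
    with ((1 - y ^ 2) * (y ^ 2 + (2 * PI * INR m) ^ 2)) by (field; lra).
  replace (4 * PI ^ 2 / (y ^ 2 + (2 * PI * INR m) ^ 2) * (INR m ^ 2 * (y ^ 2 + (2 * PI * INR m) ^ 2)))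
    with ((2 * PI * INR m) ^ 2) by (field; lra).
  assert (1 <= 2 * PI * INR m) by nra.
  assert (1 <= (2 * PI * INR m) ^ 2) by nra.
  assert (0 < y ^ 2) by nra.
  set (T := (2 * PI * INR m) ^ 2) in *; set (v := y ^ 2) in *; nra.
- assert (1 <= INR m) by (apply (le_INR 1); lia).
  assert (P : 0 < y ^ 2 + (2 * PI * INR m) ^ 2) by nra.
  replace (2 * PI ^ 2 / y * (2 * y / (y ^ 2 + (2 * PI * INR m) ^ 2))) with
    (/ ((y ^ 2 + (2 * PI * INR m) ^ 2) / (2 * PI) ^ 2)) by (field; repeat split; lra).
  apply Rinv_le_contravar; [nra|].
  replace ((y ^ 2 + (2 * PI * INR m) ^ 2) / (2 * PI) ^ 2) with (INR m ^ 2 + y ^ 2 / (2 * PI) ^ 2) by (field; lra).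
  assert (0 <= y ^ 2 / (2 * PI) ^ 2); [|lra].
  apply Rmult_le_pos; [nra|left; apply Rinv_0_lt_compat; nra].
Qed.

(* The series equals the limit Z of 2 pi^2 A(y) / y as y -> 0, where A = lambert_remainder, and the
   duplication formula for A gives Z - Z / 4 = pi^2 / 8. *)
Lemma basel : is_lim_seq (psum (fun m => / INR m ^ 2)) (PI ^ 2 / 6).
Proof.
assert (Hp := PI2_3_2).
assert (z0 : forall m, (1 <= m)%nat -> 0 <= / INR m ^ 2).
{ intros m Hm; left; apply Rinv_0_lt_compat, pow_lt, lt_0_INR; lia. }
assert (Q : forall y, 0 < y -> is_lim_seq
  (fun M => 2 * PI ^ 2 / y * psum (fun m => 2 * y / (y ^ 2 + (2 * PI * INR m) ^ 2)) M)
  (2 * PI ^ 2 / y * lambert_remainder y)).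
{ intros y Hy; apply is_lim_seq_mult'; [apply is_lim_seq_const|apply coth_partial_fractions; exact Hy]. }
(* At y = 1/2 the factor 1 - y^2 is 3/4 >= 1/2, which explains the outer factor 2 of the bound. *)
assert (Ex : exists Z : R, is_lim_seq (psum (fun m => / INR m ^ 2)) Z).
{ apply psum_bounded_lim with (2 * (2 * PI ^ 2 / (/ 2) * lambert_remainder (/ 2))); [exact z0|].
  intros M; destruct (psum_inv_square_bounds (/ 2) M ltac:(lra)) as [H _].
  assert (H2 : 2 * PI ^ 2 / / 2 * psum (fun m => 2 * / 2 / ((/ 2) ^ 2 + (2 * PI * INR m) ^ 2)) M
    <= 2 * PI ^ 2 / (/ 2) * lambert_remainder (/ 2)).
  { apply Rmult_le_compat_l; [apply Rmult_le_pos; nra|].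
    apply psum_le_lim; [|apply coth_partial_fractions; lra].
    intros k _; apply Rmult_le_pos; [lra|left; apply Rinv_0_lt_compat; nra]. }
  assert (H3 := psum_nonneg _ M z0); lra. }
destruct Ex as [Z HZ].
replace (PI ^ 2 / 6) with Z; [exact HZ|].
assert (Bd : forall y, 0 < y ->
  (1 - y ^ 2) * Z <= 2 * PI ^ 2 / y * lambert_remainder y <= Z).
{ intros y Hy; split.
  - refine (is_lim_seq_le _ _ (Finite _) (Finite _) (fun M => proj1 (psum_inv_square_bounds y M Hy)) _ (Q y Hy)).
    apply is_lim_seq_mult'; [apply is_lim_seq_const|exact HZ].
  - exact (is_lim_seq_le _ _ (Finite _) (Finite _) (fun M => proj2 (psum_inv_square_bounds y M Hy)) (Q y Hy) HZ). }
set (u := fun n => / 2 ^ n).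
assert (u0 : forall n, 0 < u n) by (intros n; apply Rinv_0_lt_compat, pow_lt; lra).
assert (ul : is_lim_seq u 0) by exact is_lim_seq_pow2_inv.
set (q := fun y => 2 * PI ^ 2 / y * lambert_remainder y).
assert (qZ : is_lim_seq (fun n => q (u n)) Z).
{ apply is_lim_seq_le_le with (fun n => (1 - u n * u n) * Z) (fun _ => Z).
  - intros n; replace (u n * u n) with (u n ^ 2) by ring; exact (Bd (u n) (u0 n)).
  - replace (Finite Z) with (Finite ((1 - 0 * 0) * Z)) by (f_equal; ring).
    apply is_lim_seq_mult'; [|apply is_lim_seq_const].
    apply is_lim_seq_minus'; [apply is_lim_seq_const|apply is_lim_seq_mult'; exact ul].
  - apply is_lim_seq_const. }
assert (E1 : is_lim_seq (fun n => q (u n) - / 4 * q (u (S n))) (Z - / 4 * Z)).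
{ apply is_lim_seq_minus'; [exact qZ|].
  apply is_lim_seq_mult'; [apply is_lim_seq_const|apply is_lim_seq_incr_1 in qZ; exact qZ]. }
assert (ul2 : is_lim_seq (fun n => u (S n)) 0) by (apply is_lim_seq_incr_1 in ul; exact ul).
assert (E2 : is_lim_seq (fun n => q (u n) - / 4 * q (u (S n))) (PI ^ 2 / 4 * (1 * / (exp 0 + 1)))).
{ apply is_lim_seq_ext with
    (fun n => PI ^ 2 / 4 * ((exp (u (S n)) - 1) / u (S n) * / (exp (u (S n)) + 1))).
  - intros n; assert (Eu : u (S n) = u n / 2).
    { unfold u; simpl; field; apply pow_nonzero; lra. }
    unfold q; rewrite Eu.
    replace (2 * PI ^ 2 / u n * lambert_remainder (u n)
      - / 4 * (2 * PI ^ 2 / (u n / 2) * lambert_remainder (u n / 2)))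
      with (2 * PI ^ 2 / u n * (lambert_remainder (u n) - lambert_remainder (u n / 2) / 2))
      by (field; apply Rgt_not_eq, u0).
    rewrite lambert_remainder_half by apply u0.
    assert (P := exp_pos (u n / 2)); field; split; [lra|apply Rgt_not_eq, u0].
  - apply is_lim_seq_mult'; [apply is_lim_seq_const|].
    apply is_lim_seq_mult'.
    + apply (is_lim_comp_seq (fun y => (exp y - 1) / y) (fun n => u (S n)) 0 1).
      * exact is_lim_div_expm1_0.
      * exists O; intros n _ E; injection E; apply Rgt_not_eq, u0.
      * exact ul2.
    + apply (is_lim_seq_continuous (fun y => / (exp y + 1)) (fun n => u (S n)) 0); [|exact ul2].
      apply continuity_pt_filterlim; apply (ex_derive_continuous (fun y => / (exp y + 1))).
      auto_derive; rewrite exp_0; lra. }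
assert (E := is_lim_seq_unique _ _ E1); rewrite (is_lim_seq_unique _ _ E2) in E.
injection E; rewrite exp_0; lra.
Qed.

(** * Sums of arctangents *)

Lemma atan_0_le (x : R) : 0 <= x -> 0 <= atan x.
Proof.
intros Hx; rewrite <- atan_0; destruct Hx; [left; now apply atan_increasing|subst; lra].
Qed.

Lemma atan_lipschitz (x y : R) : x <= y -> 0 <= atan y - atan x <= y - x.
Proof.
intros Hxy; split.
- destruct Hxy; [assert (H1 := atan_increasing x y H); lra|subst; lra].
- enough (x - atan x <= y - atan y) by lra.
  apply (derive_nonneg_le (fun t => t - atan t) (fun t => 1 - / (1 + t ^ 2))); [exact Hxy| |].
  + intros t _; auto_derive; [easy|].
    assert (0 <= t ^ 2) by apply pow2_ge_0; field; nra.
  + intros t _; assert (0 <= t ^ 2) by apply pow2_ge_0.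
    assert (/ (1 + t ^ 2) <= / 1) by (apply Rinv_le_contravar; lra); lra.
Qed.

Lemma atan_abs_lipschitz (x y : R) : Rabs (atan x - atan y) <= Rabs (x - y).
Proof.
destruct (Rle_dec x y) as [H|H].
- assert (B := atan_lipschitz x y H); rewrite !Rabs_left1 by lra; lra.
- assert (B := atan_lipschitz y x ltac:(lra)); rewrite !Rabs_pos_eq by lra; lra.
Qed.

(** This is the sign of the derivative of - atan x / x, hence the source of monotonicity of
    [atan_quot]. *)
Lemma atan_lower (x : R) : 0 <= x -> x / (1 + x ^ 2) <= atan x.
Proof.
intros Hx.
enough (H : atan 0 - 0 / (1 + 0 ^ 2) <= atan x - x / (1 + x ^ 2)).
{ rewrite atan_0 in H; replace (0 - 0 / (1 + 0 ^ 2)) with 0 in H by field; lra. }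
apply (derive_nonneg_le (fun t => atan t - t / (1 + t ^ 2)) (fun t => 2 * t ^ 2 / (1 + t ^ 2) ^ 2)); [exact Hx| |].
- intros t _; assert (0 <= t ^ 2) by apply pow2_ge_0.
  auto_derive; [simpl in *; lra|field; simpl in *; lra].
- intros t _; assert (0 <= t ^ 2) by apply pow2_ge_0.
  apply Rmult_le_pos; [lra|left; apply Rinv_0_lt_compat; nra].
Qed.

(** The value 1 at 0 makes it continuous everywhere, so its integral from 0 is differentiable at
    every point. *)
Definition atan_quot (x : R) : R := if Req_EM_T x 0 then 1 else atan x / x.

Lemma atan_quot_pos (x : R) : 0 < x -> atan_quot x = atan x / x.
Proof. intros Hx; unfold atan_quot; destruct (Req_EM_T x 0); [lra|reflexivity]. Qed.

Lemma atan_quot_bounds (x : R) : 1 - x ^ 2 <= atan_quot x <= 1.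
Proof.
assert (H : forall x, 0 < x -> 1 - x ^ 2 <= atan x / x <= 1).
{ clear x; intros x Hx.
  assert (H1 := atan_lower x ltac:(lra)); assert (H2 := atan_lipschitz 0 x ltac:(lra)).
  rewrite atan_0 in H2; assert (0 < x ^ 2) by (apply pow_lt; lra).
  split.
  - apply Rmult_le_reg_r with x; [lra|]; unfold Rdiv; rewrite Rmult_assoc, Rinv_l, Rmult_1_r by lra.
    eapply Rle_trans; [|exact H1].
    apply Rmult_le_reg_r with (1 + x ^ 2); [lra|].
    replace (x / (1 + x ^ 2) * (1 + x ^ 2)) with x by (field; lra).
    replace ((1 - x ^ 2) * x * (1 + x ^ 2)) with (x - x * (x ^ 2 * x ^ 2)) by ring.
    assert (0 <= x * (x ^ 2 * x ^ 2)) by (apply Rmult_le_pos; nra); lra.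
  - apply Rmult_le_reg_r with x; [lra|]; unfold Rdiv; rewrite Rmult_assoc, Rinv_l by lra; lra. }
unfold atan_quot; destruct (Req_EM_T x 0) as [E|E]; [subst; lra|].
destruct (Rlt_dec 0 x) as [P|P]; [now apply H|].
replace (atan x / x) with (atan (- x) / (- x)) by (rewrite atan_opp; field; lra).
replace (x ^ 2) with ((- x) ^ 2) by ring; apply H; lra.
Qed.

Lemma atan_quot_continuous (x : R) : continuous atan_quot x.
Proof.
destruct (Req_EM_T x 0) as [E|E].
- subst; apply filterlim_locally; intros eps.
  assert (E0 : atan_quot 0 = 1) by (unfold atan_quot; destruct (Req_EM_T 0 0); lra).
  assert (Hm : 0 < Rmin 1 eps) by (apply Rmin_pos; [lra|apply cond_pos]).
  exists (mkposreal _ Hm); intros y Hy.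
  unfold ball in *; simpl in *; unfold AbsRing_ball, abs, minus, plus, opp in *; simpl in *.
  rewrite E0; assert (B := atan_quot_bounds y).
  rewrite Ropp_0, Rplus_0_r in Hy.
  assert (B1 := Rmin_l 1 eps); assert (B2 := Rmin_r 1 eps).
  assert (Rabs y ^ 2 < eps) by (assert (H := Rabs_pos y); nra).
  rewrite pow2_abs in *; apply Rabs_def1; lra.
- apply continuous_ext_loc with (fun t => atan t / t).
  + assert (Hm : 0 < Rabs x) by (apply Rabs_pos_lt; exact E).
    exists (mkposreal _ Hm); intros y Hy.
    unfold ball in *; simpl in *; unfold AbsRing_ball, abs, minus, plus, opp in *; simpl in *.
    unfold atan_quot; destruct (Req_EM_T y 0) as [Y|Y]; [|reflexivity].
    subst; rewrite Rplus_0_l, Rabs_Ropp in Hy; lra.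
  + apply (ex_derive_continuous (fun t => atan t / t)); auto_derive; exact E.
Qed.

Lemma atan_quot_decreasing (x y : R) : 0 <= x <= y -> atan_quot y <= atan_quot x.
Proof.
intros [[H0|H0] H].
- rewrite !atan_quot_pos by lra.
  enough (- (atan x / x) <= - (atan y / y)) by lra.
  apply (derive_nonneg_le (fun t => - (atan t / t)) (fun t => (atan t - t / (1 + t ^ 2)) / t ^ 2)); [lra| |].
  + intros t Ht; assert (0 <= t ^ 2) by apply pow2_ge_0.
    auto_derive; [lra|field; simpl in *; repeat split; lra].
  + intros t Ht; assert (L := atan_lower t ltac:(lra)).
    apply Rmult_le_pos; [lra|left; apply Rinv_0_lt_compat, pow_lt; lra].
- subst; apply Rle_trans with 1; [apply atan_quot_bounds|].
  unfold atan_quot; destruct (Req_EM_T 0 0); lra.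
Qed.

(** With c = r / M it approximates PI times the part of the lattice sum with k <= N and m > M. *)
Definition atan_sum (N : nat) (c : R) : R := psum (fun k => atan (c * INR k) / INR k) N.

Lemma is_lim_seq_inv_INR (c : R) : is_lim_seq (fun n => c / INR n) 0.
Proof.
replace (Finite 0) with (Finite (c * 0)) by (f_equal; ring).
apply is_lim_seq_mult'; [apply is_lim_seq_const|].
replace (Finite 0) with (Rbar_inv p_infty) by reflexivity.
apply is_lim_seq_inv; [apply is_lim_seq_INR|discriminate].
Qed.

(** The factor k inside the arctangent cancels the denominator, so each term is 1-Lipschitz in c. *)
Lemma atan_sum_lipschitz (N : nat) (c d : R) :
  Rabs (atan_sum N c - atan_sum N d) <= INR N * Rabs (c - d).
Proof.
unfold atan_sum; rewrite <- psum_minus; eapply Rle_trans; [apply psum_abs|].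
rewrite <- psum_const; apply psum_le; intros k Hk.
assert (K0 : 0 < INR k) by (apply lt_0_INR; lia).
replace (atan (c * INR k) / INR k - atan (d * INR k) / INR k)
  with ((atan (c * INR k) - atan (d * INR k)) / INR k) by (field; lra).
unfold Rdiv; rewrite Rabs_mult, Rabs_inv, (Rabs_pos_eq (INR k)) by lra.
apply Rmult_le_reg_r with (INR k); [lra|]; rewrite Rmult_assoc, Rinv_l, Rmult_1_r by lra.
eapply Rle_trans; [apply atan_abs_lipschitz|].
right; rewrite <- Rmult_minus_distr_r, Rabs_mult, (Rabs_pos_eq (INR k)); lra.
Qed.

(* The Riemann sums of [atan x / x] on [0, 1]. *)
Lemma atan_sum_riemann : exists J : R, is_lim_seq (fun N => atan_sum N (/ INR N)) J.
Proof.
set (Psi := fun x => RInt atan_quot 0 x).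
assert (DPsi : forall x, is_derive Psi x (atan_quot x)).
{ intros x; apply is_derive_RInt with 0.
  - apply filter_forall; intros y; apply (RInt_correct atan_quot).
    apply ex_RInt_continuous; intros; apply atan_quot_continuous.
  - apply atan_quot_continuous. }
assert (Bd : forall N, (1 <= N)%nat ->
  Psi 1 - Psi 0 - / INR N <= atan_sum N (/ INR N) <= Psi 1 - Psi 0).
{ intros N HN.
  assert (N0 : 0 < INR N) by (apply lt_0_INR; lia).
  set (c := / INR N).
  assert (c0 : 0 < c) by (apply Rinv_0_lt_compat; lra).
  assert (Es : atan_sum N c = psum (fun k => c * atan_quot (c * INR k)) N).
  { apply psum_ext; intros k Hk; assert (0 < INR k) by (apply lt_0_INR; lia).
    rewrite atan_quot_pos by nra; field; split; lra. }
  rewrite Es.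
  (* A right Riemann sum of a decreasing function lies below the integral; the gap telescopes to c
     times the drop between the endpoints, at most c. *)
  assert (H : forall n,
    psum (fun k => c * atan_quot (c * INR k)) n <= Psi (c * INR n) - Psi 0
      <= psum (fun k => c * atan_quot (c * INR k)) n + c * (atan_quot 0 - atan_quot (c * INR n))).
  { induction n as [|n IH]; [simpl; rewrite Rmult_0_r; lra|].
    cbn [psum].
    assert (n0 := pos_INR n); assert (cn : 0 <= c * INR n) by nra.
    assert (E : c * INR (S n) = c * INR n + c) by (rewrite S_INR; ring).
    assert (c * atan_quot (c * INR (S n)) <= Psi (c * INR (S n)) - Psi (c * INR n) <= c * atan_quot (c * INR n)).
    { rewrite E; set (x := c * INR n) in *; split.
      - enough (Psi x - x * atan_quot (x + c) <= Psi (x + c) - (x + c) * atan_quot (x + c)) by lra.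
        apply (derive_nonneg_le (fun t => Psi t - t * atan_quot (x + c)) (fun t => atan_quot t - atan_quot (x + c))); [lra| |].
        + intros t Ht; apply (is_derive_minus Psi (fun t => t * atan_quot (x + c))); [apply DPsi|].
          auto_derive; [easy|ring].
        + intros t Ht; assert (D1 := atan_quot_decreasing t (x + c) ltac:(lra)); lra.
      - enough (x * atan_quot x - Psi x <= (x + c) * atan_quot x - Psi (x + c)) by lra.
        apply (derive_nonneg_le (fun t => t * atan_quot x - Psi t) (fun t => atan_quot x - atan_quot t)); [lra| |].
        + intros t Ht; apply (is_derive_minus (fun t => t * atan_quot x) Psi); [|apply DPsi].
          auto_derive; [easy|ring].
        + intros t Ht; assert (D1 := atan_quot_decreasing x t ltac:(lra)); lra. }
    lra. }
  specialize (H N); replace (c * INR N) with 1 in H by (unfold c; field; lra).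
  assert (B1 := atan_quot_bounds 0); assert (B2 := atan_quot_bounds 1).
  assert (c * (atan_quot 0 - atan_quot 1) <= c * 1) by (apply Rmult_le_compat_l; lra).
  split; lra. }
exists (Psi 1 - Psi 0).
apply is_lim_seq_le_le_loc with (fun N => Psi 1 - Psi 0 - / INR N) (fun _ => Psi 1 - Psi 0).
- exists 1%nat; intros N HN; apply Bd; lia.
- replace (Finite (Psi 1 - Psi 0)) with (Finite (Psi 1 - Psi 0 - 0)) by (f_equal; ring).
  apply is_lim_seq_minus'; [apply is_lim_seq_const|].
  apply is_lim_seq_ext with (fun N => 1 / INR N); [intros; apply Rdiv_1_l|apply is_lim_seq_inv_INR].
- apply is_lim_seq_const.
Qed.

(** The limit is Euler's constant, which cancels in the difference of the two harmonic sums in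
    [lambert_inversion]. *)
Lemma harmonic_log_lim : exists g : R, is_lim_seq (fun N => psum (fun k => / INR k) N - ln (INR N)) g.
Proof.
destruct (ex_finite_lim_seq_decr (fun n => psum (fun k => / INR k) (S n) - ln (INR (S n))) 0) as [g Hg].
- intros n; cbn [psum].
  assert (n0 := pos_INR n).
  assert (E : ln (INR (S n)) - ln (INR (S (S n))) <= - / INR (S (S n))).
  { rewrite !S_INR; rewrite <- ln_div by lra.
    eapply Rle_trans; [apply ln_le_minus_1, Rdiv_lt_0_compat; lra|right; field; lra]. }
  cbn [psum] in *; lra.
- intros n.
  assert (H : ln (INR (S (S n))) <= psum (fun k => / INR k) (S n)).
  { induction n as [|n IH].
    - simpl; assert (H := ln_le_minus_1 2 ltac:(lra)); replace (1 + 1) with 2 by ring; lra.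
    - change (psum (fun k => / INR k) (S (S n))) with (psum (fun k => / INR k) (S n) + / INR (S (S n))).
      assert (n0 := pos_INR n).
      assert (E : ln (INR (S (S (S n)))) - ln (INR (S (S n))) <= / INR (S (S n))).
      { rewrite !S_INR; rewrite <- ln_div by lra.
        eapply Rle_trans; [apply ln_le_minus_1, Rdiv_lt_0_compat; lra|right; field; lra]. }
      lra. }
  assert (n0 := pos_INR n).
  assert (ln (INR (S n)) <= ln (INR (S (S n)))) by (apply ln_le; rewrite !S_INR; lra).
  lra.
- exists g; apply is_lim_seq_incr_1; exact Hg.
Qed.

(** The middle is the integral over [t, t + 1] of the decreasing function X / (X^2 + v^2), compared
    with its endpoint values. *)
Lemma atan_inv_square_cell (X t : R) : 0 < X -> 0 < t ->
  X / (X ^ 2 + (t + 1) ^ 2) <= atan (X / t) - atan (X / (t + 1)) <= X / (X ^ 2 + t ^ 2).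
Proof.
intros HX Ht; split.
- enough (- (t * (X / (X ^ 2 + (t + 1) ^ 2))) - atan (X / t)
    <= - ((t + 1) * (X / (X ^ 2 + (t + 1) ^ 2))) - atan (X / (t + 1))) by lra.
  apply (derive_nonneg_le (fun v => - (v * (X / (X ^ 2 + (t + 1) ^ 2))) - atan (X / v))
    (fun v => X * (/ (X ^ 2 + v ^ 2) - / (X ^ 2 + (t + 1) ^ 2)))); [lra| |].
  + intros v Hv; auto_derive; [lra|field; simpl in *; repeat split; nra].
  + intros v Hv; apply Rmult_le_pos; [lra|].
    assert (/ (X ^ 2 + (t + 1) ^ 2) <= / (X ^ 2 + v ^ 2)) by (apply Rinv_le_contravar; nra); lra.
- enough (t * (X / (X ^ 2 + t ^ 2)) + atan (X / t)
    <= (t + 1) * (X / (X ^ 2 + t ^ 2)) + atan (X / (t + 1))) by lra.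
  apply (derive_nonneg_le (fun v => v * (X / (X ^ 2 + t ^ 2)) + atan (X / v))
    (fun v => X * (/ (X ^ 2 + t ^ 2) - / (X ^ 2 + v ^ 2)))); [lra| |].
  + intros v Hv; auto_derive; [lra|field; simpl in *; repeat split; nra].
  + intros v Hv; apply Rmult_le_pos; [lra|].
    assert (/ (X ^ 2 + v ^ 2) <= / (X ^ 2 + t ^ 2)) by (apply Rinv_le_contravar; nra); lra.
Qed.

(** The cells telescope, and the arctangent at the far end tends to 0. *)
Lemma inv_square_tail (X l : R) (M : nat) : 0 < X -> (1 <= M)%nat ->
  is_lim_seq (psum (fun m => X / (X ^ 2 + INR m ^ 2))) l ->
  atan (X / (INR M + 1)) <= l - psum (fun m => X / (X ^ 2 + INR m ^ 2)) M <= atan (X / INR M).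
Proof.
intros HX HM Hl; set (a := fun m => X / (X ^ 2 + INR m ^ 2)) in *.
assert (Fin : forall j,
  atan (X / (INR M + 1)) - atan (X / (INR (M + j) + 1)) <= psum a (M + j) - psum a M
  <= atan (X / INR M) - atan (X / INR (M + j))).
{ induction j as [|j IH]; [rewrite Nat.add_0_r; lra|].
  rewrite Nat.add_succ_r; cbn [psum].
  assert (P : 0 < INR (M + j)) by (apply lt_0_INR; lia).
  assert (H1 := atan_inv_square_cell X (INR (M + j)) HX P).
  assert (H2 := atan_inv_square_cell X (INR (M + j) + 1) HX ltac:(lra)).
  replace (a (S (M + j))) with (X / (X ^ 2 + (INR (M + j) + 1) ^ 2)) by (unfold a; rewrite S_INR; reflexivity).
  rewrite !S_INR; lra. }
assert (Hs : is_lim_seq (fun j => psum a (M + j)) l).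
{ apply is_lim_seq_ext with (fun j => psum a (j + M)); [intros; f_equal; lia|].
  apply -> is_lim_seq_incr_n; exact Hl. }
assert (Small : is_lim_seq (fun j => X / INR j) 0) by apply is_lim_seq_inv_INR.
assert (Tail : is_lim_seq (fun j => psum a (M + j) - psum a M) (l - psum a M)).
{ apply is_lim_seq_minus'; [exact Hs|apply is_lim_seq_const]. }
split.
- enough (atan (X / (INR M + 1)) - 0 <= l - psum a M) by lra.
  refine (is_lim_seq_le_loc (fun j => atan (X / (INR M + 1)) - X / INR j) _ (Finite _) (Finite _) _ _ Tail).
  + exists 1%nat; intros j Hj; eapply Rle_trans; [|apply Fin].
    assert (P : 0 < INR j) by (apply lt_0_INR; lia).
    assert (Q := pos_INR M).
    assert (B : 0 < X / (INR (M + j) + 1)) by (apply Rdiv_lt_0_compat; rewrite ?plus_INR; lra).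
    assert (L := atan_lipschitz 0 _ (Rlt_le _ _ B)); rewrite atan_0 in L.
    assert (X / (INR (M + j) + 1) <= X / INR j).
    { apply Rmult_le_compat_l; [lra|apply Rinv_le_contravar; rewrite ?plus_INR; lra]. }
    lra.
  + apply is_lim_seq_minus'; [apply is_lim_seq_const|exact Small].
- apply is_lim_seq_le_const with (1 := Tail); intros j.
  eapply Rle_trans; [apply Fin|].
  enough (0 <= atan (X / INR (M + j))) by lra.
  apply atan_0_le; left; apply Rdiv_lt_0_compat; [lra|apply lt_0_INR; lia].
Qed.

(** * The transformation of eta on the imaginary axis *)

(** Partial fraction m of 1/(e^y - 1) at y = 2 PI r k, divided by k. In this form, replacing r by
    1/r amounts to swapping k and m. *)
Definition lattice_term (r : R) (k m : nat) : R :=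
  r / PI / ((r * INR k) ^ 2 + INR m ^ 2).

Definition lambert_term (s : R) (k : nat) : R := / (INR k * (exp (INR k * s) - 1)).

Lemma lattice_term_sym (r : R) (k m : nat) : 0 < r -> (1 <= k)%nat ->
  lattice_term (/ r) m k = lattice_term r k m.
Proof.
intros Hr Hk; assert (K0 : 0 < INR k) by (apply lt_0_INR; lia).
assert (P : 0 < (r * INR k) ^ 2) by (apply pow_lt; nra).
assert (Q := pow2_ge_0 (INR m)); assert (Pi := PI_RGT_0).
unfold lattice_term.
replace ((/ r * INR m) ^ 2 + INR k ^ 2) with (((r * INR k) ^ 2 + INR m ^ 2) / r ^ 2) by (field; lra).
field; repeat split; lra.
Qed.

(** After subtraction of the polar parts and of the K by M rectangle, row k retains its tail m > M
    divided by k, which [inv_square_tail] encloses. The factor PI makes the enclosing terms plain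
    arctangents. *)
Lemma lambert_rectangle (r : R) (K M : nat) : 0 < r -> (1 <= M)%nat ->
  atan_sum K (r / (INR M + 1)) <=
  PI * (psum (lambert_term (2 * PI * r)) K -
        (/ (2 * PI * r) * psum (fun k => / INR k ^ 2) K - / 2 * psum (fun k => / INR k) K +
         psum (fun k => psum (lattice_term r k) M) K))
  <= atan_sum K (r / INR M).
Proof.
intros Hr HM; assert (Pi := PI_RGT_0).
assert (M0 : 0 < INR M) by (apply lt_0_INR; lia).
rewrite <- !psum_scal, <- psum_minus, <- psum_plus, <- psum_minus, <- psum_scal.
assert (H : forall k, (1 <= k)%nat ->
  atan (r / (INR M + 1) * INR k) / INR k <=
  PI * (lambert_term (2 * PI * r) k -
    (/ (2 * PI * r) * / INR k ^ 2 - / 2 * / INR k + psum (lattice_term r k) M))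
  <= atan (r / INR M * INR k) / INR k).
{ intros k Hk; assert (K0 : 0 < INR k) by (apply lt_0_INR; lia).
  set (X := r * INR k); assert (X0 : 0 < X) by (unfold X; nra).
  assert (Y0 : 0 < 2 * PI * X) by nra.
  assert (C := coth_partial_fractions (2 * PI * X) Y0); fold (lambert_remainder (2 * PI * X)) in C.
  assert (Sq : forall m, 0 < X ^ 2 + INR m ^ 2).
  { intros m; assert (Q := pow2_ge_0 (INR m)); assert (0 < X ^ 2) by nra; lra. }
  assert (C2 : is_lim_seq (psum (fun m => X / (X ^ 2 + INR m ^ 2))) (PI * lambert_remainder (2 * PI * X))).
  { eapply is_lim_seq_ext; [|exact (is_lim_seq_mult' _ _ _ _ (is_lim_seq_const PI) C)].
    intros n; cbv beta; rewrite <- psum_scal; apply psum_ext; intros m _.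
    specialize (Sq m).
    replace ((2 * PI * X) ^ 2 + (2 * PI * INR m) ^ 2) with ((2 * PI) ^ 2 * (X ^ 2 + INR m ^ 2)) by ring.
    field; split; lra. }
  assert (T := inv_square_tail X _ M X0 HM C2).
  replace (PI * (lambert_term (2 * PI * r) k -
    (/ (2 * PI * r) * / INR k ^ 2 - / 2 * / INR k + psum (lattice_term r k) M)))
    with ((PI * lambert_remainder (2 * PI * X) - psum (fun m => X / (X ^ 2 + INR m ^ 2)) M) / INR k).
  2:{ replace (psum (lattice_term r k) M) with (/ (PI * INR k) * psum (fun m => X / (X ^ 2 + INR m ^ 2)) M).
      - unfold lambert_term, lambert_remainder.
        replace (INR k * (2 * PI * r)) with (2 * PI * X) by (unfold X; ring).
        assert (Ex := exp_ineq1 (2 * PI * X) ltac:(lra)).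
        unfold X at 2; field; repeat split; lra.
      - rewrite <- psum_scal; apply psum_ext; intros m _; unfold lattice_term; fold X.
        specialize (Sq m); unfold X at 1; field; repeat split; lra. }
  replace (r / (INR M + 1) * INR k) with (X / (INR M + 1)) by (unfold X; field; lra).
  replace (r / INR M * INR k) with (X / INR M) by (unfold X; field; lra).
  split; (apply Rmult_le_compat_r; [left; apply Rinv_0_lt_compat; lra|lra]). }
unfold atan_sum; split; apply psum_le; intros k Hk; apply H; lia.
Qed.

(** The Lipschitz constant N times |c - 1/N| is |N c - 1|, so relative closeness of c to 1/N
    suffices. *)
Lemma atan_sum_near (N : nat) (c e : R) : (1 <= N)%nat -> Rabs (INR N * c - 1) <= e ->
  Rabs (atan_sum N c - atan_sum N (/ INR N)) <= e.
Proof.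
intros HN He; assert (N0 : 0 < INR N) by (apply lt_0_INR; lia).
eapply Rle_trans; [apply atan_sum_lipschitz|]; eapply Rle_trans; [|exact He].
right; rewrite <- (Rabs_pos_eq (INR N)) at 1 by lra; rewrite <- Rabs_mult; f_equal; field; lra.
Qed.

Lemma abs_quot_minus_1 (a b e : R) : 0 < b -> Rabs (a - b) <= e * b -> Rabs (a / b - 1) <= e.
Proof.
intros Hb H; replace (a / b - 1) with ((a - b) / b) by (field; lra).
unfold Rdiv; rewrite Rabs_mult, Rabs_inv, (Rabs_pos_eq b) by lra.
apply Rmult_le_reg_r with b; [lra|]; rewrite Rmult_assoc, Rinv_l, Rmult_1_r by lra; exact H.
Qed.

(** The witness is floor(r K) + 1; the added 1 keeps it positive even when r K < 1. *)
Lemma nat_approx_multiples (r : R) : 0 < r ->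
  exists M : nat -> nat, (forall K, INR (M K) - 1 <= r * INR K < INR (M K)) /\
    filterlim M eventually eventually.
Proof.
intros Hr.
assert (pf : forall K, 0 <= r * INR K) by (intros K; assert (H := pos_INR K); nra).
exists (fun K => S (proj1_sig (nfloor_ex _ (pf K)))).
assert (HM : forall K, INR (S (proj1_sig (nfloor_ex _ (pf K)))) - 1 <= r * INR K
  < INR (S (proj1_sig (nfloor_ex _ (pf K))))).
{ intros K; destruct (nfloor_ex _ (pf K)) as [n Hn]; simpl proj1_sig; rewrite S_INR; lra. }
split; [exact HM|].
intros P [N HN].
assert (pN : 0 <= INR N / r) by (apply Rmult_le_pos; [apply pos_INR|left; apply Rinv_0_lt_compat, Hr]).
destruct (nfloor_ex _ pN) as [n Hn].
exists (S n); intros K HK; apply HN; apply INR_le.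
assert (HK' : INR (S n) <= INR K) by (apply le_INR; exact HK); rewrite S_INR in HK'.
specialize (HM K).
assert (INR N <= r * INR K); [|lra].
replace (INR N) with (r * (INR N / r)) by (field; lra).
apply Rmult_le_compat_l; lra.
Qed.

(* The double sum over [lattice_term] is only conditionally convergent. Cutting it off by the
   rectangle k <= K, m <= M with M ~ r K makes the two neglected tails asymptotically equal, and
   the term [ln r / 2] is what remains of the two harmonic sums. *)
Lemma lambert_inversion (r L1 L2 : R) : 0 < r ->
  is_lim_seq (psum (lambert_term (2 * PI * r))) L1 ->
  is_lim_seq (psum (lambert_term (2 * PI * / r))) L2 ->
  L1 - L2 = PI / 12 * / r - PI / 12 * r + / 2 * ln r.
Proof.
intros Hr H1 H2; assert (Pi := PI_RGT_0).
assert (Hr' : 0 < / r) by (apply Rinv_0_lt_compat; exact Hr).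
destruct (nat_approx_multiples r Hr) as [M [HM FM]].
destruct atan_sum_riemann as [J HJ]; destruct harmonic_log_lim as [g Hg].
set (Z := psum (fun k => / INR k ^ 2)); set (h := psum (fun k => / INR k)).
(* The difference of the two rectangle defects, for r with K by M and for 1/r with M by K; their
   lattice sums are the same finite sum and have cancelled. *)
set (T := fun K => PI * (psum (lambert_term (2 * PI * r)) K - psum (lambert_term (2 * PI * / r)) (M K)
  - (/ (2 * PI * r) * Z K - / (2 * PI * / r) * Z (M K) + / 2 * (h (M K) - h K)))).
assert (HT : is_lim_seq T 0).
{ apply is_lim_seq_abs_0.
  apply is_lim_seq_le_le_loc with (fun _ => 0)
    (fun K => Rabs (atan_sum K (/ INR K) - atan_sum (M K) (/ INR (M K))) + (3 + r) / r / INR K).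
  - exists 1%nat; intros K HK; split; [apply Rabs_pos|].
    assert (K0 : 1 <= INR K) by (apply (le_INR 1); lia).
    specialize (HM K).
    assert (M1 : (1 <= M K)%nat) by (apply INR_lt; simpl; nra).
    assert (R1 := lambert_rectangle r K (M K) Hr M1).
    assert (R2 := lambert_rectangle (/ r) (M K) K Hr' HK).
    fold Z h in R1, R2.
    assert (Ex : psum (fun k => psum (lattice_term (/ r) k) K) (M K)
      = psum (fun k => psum (lattice_term r k) (M K)) K).
    { rewrite (psum_exchange (lattice_term r)); apply psum_ext; intros m Hm; apply psum_ext; intros k Hk.
      apply lattice_term_sym; [exact Hr|lia]. }
    rewrite Ex in R2; clear Ex.
    set (F := psum (fun k => psum (lattice_term r k) (M K)) K) in *.
    set (U := PI * (psum (lambert_term (2 * PI * r)) K - (/ (2 * PI * r) * Z K - / 2 * h K + F))) in *.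
    set (V := PI * (psum (lambert_term (2 * PI * / r)) (M K)
      - (/ (2 * PI * / r) * Z (M K) - / 2 * h (M K) + F))) in *.
    replace (T K) with (U - V) by (unfold T, U, V; ring).
    set (m := INR (M K)) in *; set (n := INR K) in *.
    assert (m0 : 0 < m) by nra.
    (* Since r K < M <= r K + 1, all four arctangent scales agree with 1/K or 1/M up to a relative
       error O(1/K), so both defects tend to the same Riemann integral. *)
    assert (A1 : Rabs (atan_sum K (r / (m + 1)) - atan_sum K (/ n)) <= 2 / (r * n)).
    { apply atan_sum_near; [exact HK|]; fold n.
      replace (n * (r / (m + 1))) with (r * n / (m + 1)) by (field; lra).
      apply abs_quot_minus_1; [lra|].
      replace (2 / (r * n) * (m + 1)) with (2 * ((m + 1) / (r * n))) by (field; nra).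
      assert (1 <= (m + 1) / (r * n)).
      { apply Rmult_le_reg_r with (r * n); [nra|]; unfold Rdiv; rewrite Rmult_assoc, Rinv_l by nra; lra. }
      rewrite Rabs_left1; lra. }
    assert (A2 : Rabs (atan_sum K (r / m) - atan_sum K (/ n)) <= 2 / (r * n)).
    { apply atan_sum_near; [exact HK|]; fold n.
      replace (n * (r / m)) with (r * n / m) by (field; lra).
      apply abs_quot_minus_1; [lra|].
      replace (2 / (r * n) * m) with (2 * (m / (r * n))) by (field; nra).
      assert (1 <= m / (r * n)).
      { apply Rmult_le_reg_r with (r * n); [nra|]; unfold Rdiv; rewrite Rmult_assoc, Rinv_l by nra; lra. }
      rewrite Rabs_left1; lra. }
    assert (A3 : Rabs (atan_sum (M K) (/ r / (n + 1)) - atan_sum (M K) (/ m)) <= (1 + r) / (r * n)).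
    { apply atan_sum_near; [exact M1|]; fold m.
      replace (m * (/ r / (n + 1))) with (m / (r * (n + 1))) by (field; lra).
      apply abs_quot_minus_1; [nra|].
      replace ((1 + r) / (r * n) * (r * (n + 1))) with ((1 + r) * (1 + / n)) by (field; lra).
      assert (0 < / n) by (apply Rinv_0_lt_compat; lra).
      apply Rabs_le; split; nra. }
    assert (A4 : Rabs (atan_sum (M K) (/ r / n) - atan_sum (M K) (/ m)) <= (1 + r) / (r * n)).
    { apply atan_sum_near; [exact M1|]; fold m.
      replace (m * (/ r / n)) with (m / (r * n)) by (field; lra).
      apply abs_quot_minus_1; [nra|].
      replace ((1 + r) / (r * n) * (r * n)) with (1 + r) by (field; lra).
      apply Rabs_le; split; lra. }
    replace ((3 + r) / r / n) with (2 / (r * n) + (1 + r) / (r * n)) by (field; lra).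
    assert (B1 := Rle_abs (atan_sum K (/ n) - atan_sum (M K) (/ m))).
    assert (B2 := Rle_abs (- (atan_sum K (/ n) - atan_sum (M K) (/ m)))).
    rewrite Rabs_Ropp in B2.
    apply Rabs_le_between in A1; apply Rabs_le_between in A2; apply Rabs_le_between in A3; apply Rabs_le_between in A4.
    apply Rabs_le; split; lra.
  - apply is_lim_seq_const.
  - replace (Finite 0) with (Finite (Rabs (J - J) + 0)) by (f_equal; rewrite Rminus_diag, Rabs_R0; ring).
    apply is_lim_seq_plus'; [|apply is_lim_seq_inv_INR].
    apply (is_lim_seq_abs _ (Finite (J - J))).
    apply is_lim_seq_minus'; [exact HJ|].
    exact (is_lim_seq_subseq (fun N => atan_sum N (/ INR N)) _ _ FM HJ). }
assert (Hln : is_lim_seq (fun K => ln (INR (M K) / INR K)) (ln r)).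
{ apply (is_lim_seq_continuous ln (fun K => INR (M K) / INR K) r).
  - apply continuity_pt_filterlim; apply (ex_derive_continuous ln); auto_derive; exact Hr.
  - apply is_lim_seq_le_le_loc with (fun _ => r) (fun K => r + 1 / INR K).
    + exists 1%nat; intros K HK; specialize (HM K).
      assert (K0 : 0 < INR K) by (apply lt_0_INR; lia).
      split; apply Rmult_le_reg_r with (INR K); try lra.
      * unfold Rdiv; rewrite Rmult_assoc, Rinv_l by lra; lra.
      * replace (INR (M K) / INR K * INR K) with (INR (M K)) by (field; lra).
        replace ((r + 1 / INR K) * INR K) with (r * INR K + 1) by (field; lra); lra.
    + apply is_lim_seq_const.
    + replace (Finite r) with (Finite (r + 0)) by (f_equal; ring).
      apply is_lim_seq_plus'; [apply is_lim_seq_const|apply is_lim_seq_inv_INR]. }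
assert (Hh : is_lim_seq (fun K => h (M K) - h K) (g - g + ln r)).
{ apply is_lim_seq_ext_loc with
    (fun K => ((h (M K) - ln (INR (M K))) - (h K - ln (INR K))) + ln (INR (M K) / INR K)).
  - exists 1%nat; intros K HK; specialize (HM K).
    assert (K0 : 0 < INR K) by (apply lt_0_INR; lia).
    rewrite ln_div by nra; ring.
  - apply is_lim_seq_plus'; [|exact Hln]; apply is_lim_seq_minus'; [|exact Hg].
    exact (is_lim_seq_subseq _ _ _ FM Hg). }
assert (HT2 : is_lim_seq T (PI * (L1 - L2 - (/ (2 * PI * r) * (PI ^ 2 / 6) - / (2 * PI * / r) * (PI ^ 2 / 6)
  + / 2 * (g - g + ln r))))).
{ apply is_lim_seq_mult'; [apply is_lim_seq_const|].
  apply is_lim_seq_minus'.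
  - apply is_lim_seq_minus'; [exact H1|exact (is_lim_seq_subseq _ _ _ FM H2)].
  - apply is_lim_seq_plus'.
    + apply is_lim_seq_minus'; (apply is_lim_seq_mult'; [apply is_lim_seq_const|]).
      * exact basel.
      * exact (is_lim_seq_subseq _ _ _ FM basel).
    + apply is_lim_seq_mult'; [apply is_lim_seq_const|exact Hh]. }
assert (E := is_lim_seq_unique _ _ HT); rewrite (is_lim_seq_unique _ _ HT2) in E.
apply Rbar_finite_eq in E.
apply Rmult_integral in E; destruct E as [E|E]; [lra|].
replace (/ (2 * PI * r) * (PI ^ 2 / 6)) with (PI / 12 * / r) in E by (field; lra).
replace (/ (2 * PI * / r) * (PI ^ 2 / 6)) with (PI / 12 * r) in E by (field; lra).
lra.
Qed.

(** * The quotient of the Euler product by its approximation *)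

Lemma partial_prod_exp (x : R) (N : nat) : 0 < x < 1 ->
  partial_prod (fun n => 1 - x ^ n) N = exp (- psum (fun n => - ln (1 - x ^ n)) N).
Proof.
intros Hx; induction N as [|N IH]; cbn [partial_prod psum].
- rewrite Ropp_0, exp_0; reflexivity.
- assert (B := pow_bounds x (S N) Hx ltac:(lia)).
  rewrite IH, Ropp_plus_distr, Ropp_involutive, exp_plus, exp_ln by lra; reflexivity.
Qed.

(** Convergence of the logarithms makes the limit in [inf_prod] a genuine finite one, exp(-L), so
    the default value of [real] at infinity does not enter. *)
Lemma ln_R_1_lim (x : R) : 0 < x < 1 ->
  0 < R_1 x /\ is_lim_seq (psum (fun n => - ln (1 - x ^ n))) (- ln (R_1 x)).
Proof.
intros Hx; destruct (euler_log_lim x Hx) as [L HL].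
assert (E : R_1 x = exp (- L)).
{ unfold R_1, inf_prod.
  rewrite (is_lim_seq_unique _ (exp (- L))); [reflexivity|].
  apply is_lim_seq_ext with (fun N => exp (- psum (fun n => - ln (1 - x ^ n)) N)).
  - intros N; symmetry; apply partial_prod_exp; exact Hx.
  - apply (is_lim_seq_continuous (fun t => exp (- t)) _ L); [|exact HL].
    apply continuity_pt_filterlim; apply (ex_derive_continuous (fun t => exp (- t))); auto_derive; easy. }
rewrite E, ln_exp, Ropp_involutive; split; [apply exp_pos|exact HL].
Qed.

(** This is exp(2 pi i tau) at tau = i/u, so that u -> 1/u is tau -> -1/tau. *)
Definition nome (u : R) : R := exp (- (2 * PI / u)).

Definition log_euler (u : R) : R := ln (R_1 (nome u)).

Lemma nome_bounds (u : R) : 0 < u -> 0 < nome u < 1.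
Proof.
intros Hu; assert (Pi := PI_RGT_0); apply exp_neg_lt_1, Rdiv_lt_0_compat; lra.
Qed.

Lemma nome_pow (u : R) (n : nat) : nome u ^ n = exp (- (2 * PI * INR n / u)).
Proof. unfold nome; rewrite exp_pow; f_equal; unfold Rdiv; ring. Qed.

Lemma log_euler_lim (u : R) : 0 < u ->
  is_lim_seq (psum (fun n => ln (1 - nome u ^ n))) (log_euler u).
Proof.
intros Hu; destruct (ln_R_1_lim (nome u) (nome_bounds u Hu)) as [_ H].
apply (is_lim_seq_opp _ (Finite _)) in H; simpl in H; rewrite Ropp_involutive in H.
eapply is_lim_seq_ext; [|exact H].
intros N; cbv beta; rewrite <- (Rmult_1_l (- psum _ N)), <- Ropp_mult_distr_r, Ropp_mult_distr_l, <- psum_scal.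
apply psum_ext; intros; ring.
Qed.

(** The logarithm of eta(i u) = u^(-1/2) eta(i/u), read off from the Lambert series, whose sum at s
    = 2 PI / v is minus [log_euler] v. *)
Lemma log_euler_inversion (u : R) : 0 < u ->
  log_euler (/ u) - log_euler u = PI / 12 * u - PI / 12 * / u - / 2 * ln u.
Proof.
intros Hu; assert (Pi := PI_RGT_0).
assert (Hu' : 0 < / u) by (apply Rinv_0_lt_compat; exact Hu).
assert (L : forall v, 0 < v -> is_lim_seq (psum (lambert_term (2 * PI * / v))) (- log_euler v)).
{ intros v Hv; apply (euler_log_lambert (2 * PI * / v)).
  - apply Rmult_lt_0_compat; [lra|apply Rinv_0_lt_compat; exact Hv].
  - apply (ln_R_1_lim (nome v) (nome_bounds v Hv)). }
assert (H := lambert_inversion (/ u) _ _ Hu' (L u Hu) (L (/ u) Hu')).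
rewrite Rinv_inv, ln_Rinv in H by exact Hu; lra.
Qed.

(** * Concavity and the maximum at u = 1 *)

(** The tangent at the intermediate point lies below f; its values at u and v average to f there.
    The interval is open at a, where the functions of interest may be singular, and closed at b,
    since u = 1 must be included. *)
Lemma convex_of_derive (f df : R -> R) (a b u v l : R) :
  (forall x, a < x <= b -> is_derive f x (df x)) ->
  (forall x y, a < x -> x <= y -> y <= b -> df x <= df y) ->
  a < u <= b -> a < v <= b -> 0 <= l <= 1 ->
  f (l * u + (1 - l) * v) <= l * f u + (1 - l) * f v.
Proof.
intros Hd Hm Hu Hv Hl; set (w := l * u + (1 - l) * v).
assert (Hw : a < w <= b).
{ assert (Rmin u v <= w <= Rmax u v).
  { unfold w, Rmin, Rmax; destruct (Rle_dec u v); split; nra. }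
  unfold Rmin, Rmax in *; destruct (Rle_dec u v); lra. }
assert (T : forall t, a < t <= b -> f w + df w * (t - w) <= f t).
{ intros t Ht; destruct (Rle_dec w t) as [H|H].
  - enough (f w - df w * w <= f t - df w * t) by lra.
    apply (derive_nonneg_le (fun x => f x - df w * x) (fun x => df x - df w)); [exact H| |].
    + intros x Hx; apply (is_derive_minus f (fun x => df w * x)); [apply Hd; lra|auto_derive; [easy|ring]].
    + intros x Hx; assert (H1 := Hm w x ltac:(lra) ltac:(lra) ltac:(lra)); lra.
  - enough (df w * t - f t <= df w * w - f w) by lra.
    apply (derive_nonneg_le (fun x => df w * x - f x) (fun x => df w - df x)); [lra| |].
    + intros x Hx; apply (is_derive_minus (fun x => df w * x) f); [auto_derive; [easy|ring]|apply Hd; lra].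
    + intros x Hx; assert (H1 := Hm x w ltac:(lra) ltac:(lra) ltac:(lra)); lra. }
assert (Tu := T u Hu); assert (Tv := T v Hv).
apply Rmult_le_compat_l with (r := l) in Tu; [|lra].
apply Rmult_le_compat_l with (r := 1 - l) in Tv; [|lra].
assert (E : l * (f w + df w * (u - w)) + (1 - l) * (f w + df w * (v - w)) = f w) by (unfold w at 3 6; ring).
lra.
Qed.

(** The second derivative has the sign of b - 2 t, whence the bound b/2. *)
Lemma exp_inv_convex (b u v l : R) : 0 < u <= b / 2 -> 0 < v <= b / 2 -> 0 <= l <= 1 ->
  exp (- (b / (l * u + (1 - l) * v))) <= l * exp (- (b / u)) + (1 - l) * exp (- (b / v)).
Proof.
intros Hu Hv Hl.
apply (convex_of_derive (fun t => exp (- (b / t))) (fun t => b / t ^ 2 * exp (- (b / t))) 0 (b / 2));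
  [| |exact Hu|exact Hv|exact Hl].
- intros x Hx; auto_derive; [lra|fold (b / x); field; lra].
- intros x y Hx Hxy Hy.
  apply (derive_nonneg_le (fun t => b / t ^ 2 * exp (- (b / t)))
    (fun t => b / t ^ 4 * (b - 2 * t) * exp (- (b / t)))); [exact Hxy| |].
  + intros t Ht; auto_derive; [split; [apply Rgt_not_eq; nra|split; [lra|easy]]|fold (b / t); field; lra].
  + intros t Ht; apply Rmult_le_pos; [|left; apply exp_pos].
    apply Rmult_le_pos; [|lra].
    apply Rmult_le_pos; [lra|left; apply Rinv_0_lt_compat, pow_lt; lra].
Qed.

Lemma ln_concave (u v l : R) : 0 < u -> 0 < v -> 0 <= l <= 1 ->
  l * ln u + (1 - l) * ln v <= ln (l * u + (1 - l) * v).
Proof.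
intros Hu Hv Hl.
enough (- ln (l * u + (1 - l) * v) <= l * - ln u + (1 - l) * - ln v) by lra.
apply (convex_of_derive (fun t => - ln t) (fun t => - / t) 0 (Rmax u v)).
- intros x Hx; auto_derive; [lra|field; lra].
- intros x y Hx Hxy _; assert (/ y <= / x) by (apply Rinv_le_contravar; lra); lra.
- split; [exact Hu|apply Rmax_l].
- split; [exact Hv|apply Rmax_r].
- exact Hl.
Qed.

(** Termwise, ln is increasing and concave and 1 - exp(-2 PI n / u) is concave for u <= PI n. The
    bound 3 is below PI and leaves room for pairs w, 1/w around 1. *)
Lemma log_euler_concave (u v l : R) : 0 < u <= 3 -> 0 < v <= 3 -> 0 <= l <= 1 ->
  l * log_euler u + (1 - l) * log_euler v <= log_euler (l * u + (1 - l) * v).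
Proof.
intros Hu Hv Hl; assert (Pi := PI2_3_2).
assert (Hw : 0 < l * u + (1 - l) * v) by (destruct (Rle_dec l (/ 2)); nra).
assert (Lu := log_euler_lim u ltac:(lra)); assert (Lv := log_euler_lim v ltac:(lra)).
assert (Lw := log_euler_lim _ Hw).
refine (is_lim_seq_le _ _ (Finite _) (Finite _) _
  (is_lim_seq_plus' _ _ _ _ (is_lim_seq_mult' _ _ _ _ (is_lim_seq_const l) Lu)
     (is_lim_seq_mult' _ _ _ _ (is_lim_seq_const (1 - l)) Lv)) Lw).
intros N; cbv beta; rewrite <- !psum_scal, <- psum_plus; apply psum_le; intros n Hn.
assert (N1 : 1 <= INR n) by (apply (le_INR 1); lia).
assert (Bu := pow_bounds _ n (nome_bounds u ltac:(lra)) ltac:(lia)).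
assert (Bv := pow_bounds _ n (nome_bounds v ltac:(lra)) ltac:(lia)).
assert (Cu := nome_bounds u ltac:(lra)); assert (Cv := nome_bounds v ltac:(lra)).
eapply Rle_trans; [apply ln_concave; [lra|lra|exact Hl]|].
apply ln_le; [destruct (Rle_dec l (/ 2)); nra|].
enough (nome (l * u + (1 - l) * v) ^ n <= l * nome u ^ n + (1 - l) * nome v ^ n) by lra.
rewrite !nome_pow; apply exp_inv_convex; [nra|nra|exact Hl].
Qed.

Lemma log_euler_decreasing (u v : R) : 0 < u <= v -> log_euler v <= log_euler u.
Proof.
intros Huv; assert (Pi := PI_RGT_0).
assert (Bu := nome_bounds u ltac:(lra)); assert (Bv := nome_bounds v ltac:(lra)).
refine (is_lim_seq_le _ _ (Finite _) (Finite _) _ (log_euler_lim v ltac:(lra)) (log_euler_lim u ltac:(lra))).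
intros N; apply psum_le; intros n Hn.
assert (B := pow_bounds _ n Bv ltac:(lia)).
apply ln_le; [lra|].
enough (nome u ^ n <= nome v ^ n) by lra.
apply pow_incr; split; [lra|].
assert (H : - (2 * PI / u) <= - (2 * PI / v)).
{ apply Ropp_le_contravar, Rmult_le_compat_l; [lra|apply Rinv_le_contravar; lra]. }
unfold nome; destruct H as [H|H]; [left; apply exp_increasing, H|rewrite H; lra].
Qed.

Lemma log_euler_ge (u : R) : 0 < u -> - (nome u / (1 - nome u) ^ 2) <= log_euler u.
Proof.
intros Hu; assert (B := nome_bounds u Hu); set (q := nome u) in *.
assert (G := is_lim_seq_geom_from_1 q ltac:(lra)).
assert (L := log_euler_lim u Hu); fold q in L.
replace (- (q / (1 - q) ^ 2)) with (- / (1 - q) * (q / (1 - q))) by (field; lra).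
refine (is_lim_seq_le _ _ (Finite _) (Finite _) _ (is_lim_seq_mult' _ _ _ _ (is_lim_seq_const _) G) L).
intros N; cbv beta; rewrite <- psum_scal; apply psum_le; intros n Hn.
assert (Bn := pow_bounds q n B ltac:(lia)).
assert (N1 := neg_ln_bounds (q ^ n) ltac:(lra)).
assert (q ^ n / (1 - q ^ n) <= q ^ n * / (1 - q)).
{ apply Rmult_le_compat_l; [lra|apply Rinv_le_contravar; lra]. }
lra.
Qed.

Definition log_ratio (u : R) : R := PI / 12 * u - / 4 * ln (1 + u ^ 2) + log_euler u.

Lemma log_ratio_inv (u : R) : 0 < u -> log_ratio (/ u) = log_ratio u.
Proof.
intros Hu; unfold log_ratio.
assert (H := log_euler_inversion u Hu).
assert (P : 0 < u ^ 2) by (apply pow_lt; exact Hu).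
replace (1 + (/ u) ^ 2) with ((1 + u ^ 2) / (u * u)) by (field; lra).
rewrite ln_div, ln_mult by nra; lra.
Qed.

(** The restriction to u <= 1 comes from ln(1 + t^2): its derivative 2 t / (1 + t^2) increases only
    up to t = 1. *)
Lemma log_ratio_concave (u v l : R) : 0 < u <= 1 -> 0 < v <= 1 -> 0 <= l <= 1 ->
  l * log_ratio u + (1 - l) * log_ratio v <= log_ratio (l * u + (1 - l) * v).
Proof.
intros Hu Hv Hl; unfold log_ratio.
assert (H1 := log_euler_concave u v l ltac:(lra) ltac:(lra) Hl).
assert (H2 : ln (1 + (l * u + (1 - l) * v) ^ 2) <= l * ln (1 + u ^ 2) + (1 - l) * ln (1 + v ^ 2)).
{ apply (convex_of_derive (fun t => ln (1 + t ^ 2)) (fun t => 2 * (t / (1 + t ^ 2))) 0 1);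
    [| |exact Hu|exact Hv|exact Hl].
  - intros x Hx; assert (0 < x ^ 2) by (apply pow_lt; lra).
    auto_derive; [simpl in *; lra|field; simpl in *; lra].
  - intros x y Hx Hxy Hy.
    assert (0 < 1 + x ^ 2) by nra; assert (0 < 1 + y ^ 2) by nra.
    apply Rmult_le_compat_l; [lra|].
    apply Rmult_le_reg_r with ((1 + x ^ 2) * (1 + y ^ 2)); [apply Rmult_lt_0_compat; assumption|].
    replace (x / (1 + x ^ 2) * ((1 + x ^ 2) * (1 + y ^ 2))) with (x * (1 + y ^ 2)) by (field; lra).
    replace (y / (1 + y ^ 2) * ((1 + x ^ 2) * (1 + y ^ 2))) with (y * (1 + x ^ 2)) by (field; lra).
    assert (0 <= (y - x) * (1 - x * y)) by (apply Rmult_le_pos; nra); lra. }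
lra.
Qed.

(** By symmetry the left side is [log_ratio] w + [log_ratio] (/ w). The Euler parts are bounded by
    concavity at the mean of w and 1/w, which is at least 1, and by monotonicity. The logarithms are
    controlled by (1 + w^2)(1 + w^(-2)) = 4 + (w - 1/w)^2 >= 4. The error comes from the linear
    term, as w + 1/w = 2 + (1 - w)^2 / w. *)
Lemma log_ratio_near_1 (w : R) : / 3 <= w <= 1 ->
  2 * log_ratio w <= 2 * log_ratio 1 + PI / 12 * ((1 - w) ^ 2 / w).
Proof.
intros Hw; assert (Pi := PI_RGT_0).
assert (I1 : 1 <= / w) by (rewrite <- Rinv_1; apply Rinv_le_contravar; lra).
assert (I3 : / w <= 3) by (rewrite <- (Rinv_inv 3); apply Rinv_le_contravar; lra).
assert (E := log_ratio_inv w ltac:(lra)).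
assert (Cc := log_euler_concave w (/ w) (/ 2) ltac:(lra) ltac:(lra) ltac:(lra)).
assert (Q : / 2 * w + (1 - / 2) * / w = 1 + (1 - w) ^ 2 / w / 2) by (field; lra).
assert (Q0 : 0 <= (1 - w) ^ 2 / w).
{ apply Rmult_le_pos; [apply pow2_ge_0|left; apply Rinv_0_lt_compat; lra]. }
assert (D := log_euler_decreasing 1 (/ 2 * w + (1 - / 2) * / w) ltac:(lra)).
assert (W : w + / w = 2 + (1 - w) ^ 2 / w) by (field; lra).
assert (L : 2 * ln (1 + 1 ^ 2) <= ln (1 + w ^ 2) + ln (1 + (/ w) ^ 2)).
{ assert (0 < w ^ 2) by (apply pow_lt; lra); assert (0 < (/ w) ^ 2) by (apply pow_lt; lra).
  replace (2 * ln (1 + 1 ^ 2)) with (ln (1 + 1 ^ 2) + ln (1 + 1 ^ 2)) by ring.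
  rewrite <- !ln_mult by lra.
  apply ln_le; [lra|].
  replace ((1 + w ^ 2) * (1 + (/ w) ^ 2)) with (4 + (w - / w) ^ 2) by (field; lra).
  assert (T := pow2_ge_0 (w - / w)); lra. }
unfold log_ratio in *; nra.
Qed.

(* A concave function exceeding its value at 1 somewhere does so at rate at least linear in the
   distance to 1, which the quadratic bound above forbids. *)
Lemma log_ratio_max_left (u : R) : 0 < u <= 1 -> log_ratio u <= log_ratio 1.
Proof.
intros Hu; destruct (Rle_dec (log_ratio u) (log_ratio 1)) as [H|H]; [exact H|exfalso].
set (d := log_ratio u - log_ratio 1); assert (d0 : 0 < d) by (unfold d; lra).
(* The bound 1/2 keeps w >= 1/2, so that (1 - w)^2 / w <= 2 t^2. The bound d makes the concave gain
   2 t d at least 2 t^2, more than the permitted (PI / 6) t^2. *)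
set (t := Rmin (/ 2) d).
assert (Ht : 0 < t) by (apply Rmin_pos; lra).
assert (Ht1 : t <= / 2) by apply Rmin_l; assert (Ht2 : t <= d) by apply Rmin_r.
assert (C := log_ratio_concave u 1 t Hu ltac:(lra) ltac:(lra)).
set (w := t * u + (1 - t) * 1) in *.
assert (Hw : / 2 <= w <= 1) by (unfold w; split; nra).
assert (N := log_ratio_near_1 w ltac:(lra)).
assert (Q : (1 - w) ^ 2 / w <= 2 * t ^ 2).
{ apply Rmult_le_reg_r with w; [lra|]; unfold Rdiv; rewrite Rmult_assoc, Rinv_l, Rmult_1_r by lra.
  assert (0 <= 1 - w <= t) by (unfold w; split; nra).
  assert ((1 - w) ^ 2 <= t ^ 2) by (apply pow_incr; lra).
  assert (0 <= t ^ 2) by apply pow2_ge_0; nra. }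
assert (P4 := PI_4); assert (P0 := PI_RGT_0).
assert (B : 2 * (t * d) <= PI / 12 * (2 * t ^ 2)).
{ apply Rle_trans with (PI / 12 * ((1 - w) ^ 2 / w)); [|apply Rmult_le_compat_l; lra].
  unfold d; lra. }
assert (0 < t * t) by nra; nra.
Qed.

Lemma log_ratio_max (u : R) : 0 < u -> log_ratio u <= log_ratio 1.
Proof.
intros Hu; destruct (Rle_dec u 1) as [H|H]; [apply log_ratio_max_left; lra|].
rewrite <- log_ratio_inv by exact Hu; apply log_ratio_max_left.
split; [apply Rinv_0_lt_compat; exact Hu|].
rewrite <- Rinv_1; apply Rinv_le_contravar; lra.
Qed.

(** * Positivity *)

(** [log_ratio_pos] needs PI/12 > 1/4 + 1/126, for which PI > 3 is too weak. *)
Lemma PI_gt_3_14 : 3.14 < PI.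
Proof.
assert (H := PI_2_3_7_ineq 1); destruct H as [H _].
unfold PI_2_3_7_tg, tg_alt, Ratan_seq in H; simpl in H; lra.
Qed.

(** As 2 PI > 6, exp(2 PI / u) is at least e^6 exp(6 (1/u - 1)). Here e^6 >= (3/2)^12 > 128 and the
    second factor is at least 1/u. A bound linear in u is needed because [log_ratio] tends to 0 with
    u. *)
Lemma nome_le (u : R) : 0 < u <= 1 -> nome u <= u / 128.
Proof.
intros Hu; assert (Pi := PI2_3_2).
assert (H1 : 1 + 6 * (/ u - 1) <= exp (6 * (/ u - 1))) by apply exp_ineq1_le.
assert (H2 : 128 <= exp 6).
{ replace 6 with (INR 12 * / 2) by (simpl; field); rewrite <- exp_pow.
  assert (H := exp_ineq1_le (/ 2)).
  apply Rle_trans with ((1 + / 2) ^ 12); [simpl; lra|apply pow_incr; lra]. }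
assert (I : 1 <= / u) by (rewrite <- Rinv_1; apply Rinv_le_contravar; lra).
assert (H3 : 128 * / u <= exp (2 * PI / u)).
{ apply Rle_trans with (exp (6 + 6 * (/ u - 1))).
  - rewrite exp_plus; apply Rmult_le_compat; lra.
  - replace (6 + 6 * (/ u - 1)) with (6 * / u) by ring.
    left; apply exp_increasing, Rmult_lt_compat_r; lra. }
unfold nome; rewrite exp_Ropp.
replace (u / 128) with (/ (128 * / u)) by (field; lra).
apply Rinv_le_contravar; lra.
Qed.

(** For u <= 1, ln(1 + u^2) <= u^2 <= u and the Euler part is at least -u/126, where 126 <= 128
    (127/128)^2. So the value is at least u (PI/12 - 1/4 - 1/126). Symmetry covers u > 1. *)
Lemma log_ratio_pos (u : R) : 0 < u -> 0 < log_ratio u.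
Proof.
assert (H : forall u, 0 < u <= 1 -> 0 < log_ratio u).
{ clear u; intros u Hu.
  assert (L := log_euler_ge u ltac:(lra)); assert (B := nome_bounds u ltac:(lra)).
  assert (N := nome_le u Hu); assert (Pi := PI_gt_3_14).
  set (q := nome u) in *.
  assert (Q : q / (1 - q) ^ 2 <= u / 126).
  { assert ((127 / 128) ^ 2 <= (1 - q) ^ 2) by (apply pow_incr; lra).
    apply Rmult_le_reg_r with ((1 - q) ^ 2); [lra|].
    unfold Rdiv at 1; rewrite Rmult_assoc, Rinv_l, Rmult_1_r by lra; nra. }
  assert (Ln : ln (1 + u ^ 2) <= u ^ 2).
  { rewrite <- (ln_exp (u ^ 2)) at 2; apply ln_le; [nra|apply exp_ineq1_le]. }
  unfold log_ratio; nra. }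
intros Hu; destruct (Rle_dec u 1) as [H1|H1]; [apply H; lra|].
rewrite <- log_ratio_inv by exact Hu; apply H.
split; [apply Rinv_0_lt_compat; exact Hu|].
rewrite <- Rinv_1; apply Rinv_le_contravar; lra.
Qed.

(** * The value eta(i) and the conclusion *)

Lemma Cpartial_prod_RtoC (a : nat -> R) (b : nat -> C) (N : nat) :
  (forall n, b n = RtoC (a n)) -> Cpartial_prod b N = RtoC (partial_prod a N).
Proof.
intros H; induction N as [|N IH]; cbn [Cpartial_prod partial_prod]; [reflexivity|].
rewrite IH, H, RtoC_mult; reflexivity.
Qed.

Lemma Cexp_RtoC (t : R) : Cexp (RtoC t) = RtoC (exp t).
Proof. unfold Cexp, RtoC; simpl; rewrite cos_0, sin_0; f_equal; ring. Qed.

Lemma dedekind_eta_Ci : Re (dedekind_eta Ci) = exp (- (PI / 12)) * R_1 (nome 1).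
Proof.
unfold dedekind_eta.
replace (RtoC PI * Ci * Ci / RtoC 12)%C with (RtoC (- (PI / 12))).
2:{ unfold Rdiv; rewrite RtoC_opp, RtoC_mult, RtoC_inv by lra.
    replace (RtoC PI * Ci * Ci)%C with (- RtoC PI)%C; [unfold Cdiv; ring|].
    unfold RtoC, Ci, Cmult, Copp; simpl; f_equal; ring. }
rewrite Cexp_RtoC.
assert (E : forall n, (RtoC 1 - Cexp (RtoC 2 * RtoC PI * Ci * RtoC (INR n) * Ci))%C = RtoC (1 - nome 1 ^ n)).
{ intros n; rewrite nome_pow.
  replace (RtoC 2 * RtoC PI * Ci * RtoC (INR n) * Ci)%C with (RtoC (- (2 * PI * INR n / 1))).
  - rewrite Cexp_RtoC, <- RtoC_minus; reflexivity.
  - unfold RtoC, Ci, Cmult; simpl; f_equal; field. }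
unfold Cinf_prod, R_1, inf_prod.
rewrite (Lim_seq_ext (fun N => Re (Cpartial_prod
    (fun n => (RtoC 1 - Cexp (RtoC 2 * RtoC PI * Ci * RtoC (INR n) * Ci))%C) N))
  (partial_prod (fun n => 1 - nome 1 ^ n))).
2:{ intros N; rewrite (Cpartial_prod_RtoC _ _ N E); reflexivity. }
(* The exponential prefactor is real, so the imaginary part of the product is multiplied by 0. *)
unfold RtoC, Cmult; simpl; ring.
Qed.

(** The exponents PI/6 and -PI/12, the latter from eta(i), add up to the linear term PI/12, and
    2^(-1/4) is (1 + u^2)^(-1/4) at u = 1. *)
Lemma C_const_exp : C_const = exp (log_ratio 1).
Proof.
destruct (ln_R_1_lim (nome 1) (nome_bounds 1 ltac:(lra))) as [P _].
unfold C_const, Rpower; rewrite dedekind_eta_Ci.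
rewrite <- (exp_ln (R_1 (nome 1))) by exact P; fold (log_euler 1).
rewrite <- !exp_plus; f_equal; unfold log_ratio.
replace (1 + 1 ^ 2) with 2 by ring; field.
Qed.

Theorem corollary2p4 :
  forall x : R, 0 < x < 1 ->
    exp (PI ^ 2 / (6 * ln x)) < R0_1 x /\
    R0_1 x < R_1 x /\
    R_1 x <= C_const * R0_1 x.
Proof.
intros x Hx; assert (Pi := PI_RGT_0).
assert (Hl : ln x < 0) by (rewrite <- ln_1; apply ln_increasing; lra).
set (u := - (2 * PI / ln x)).
assert (Hu : 0 < u).
{ unfold u; replace (- (2 * PI / ln x)) with (2 * PI / - ln x) by (field; lra).
  apply Rdiv_lt_0_compat; lra. }
assert (Eln : ln x = - (2 * PI / u)) by (unfold u; field; split; lra).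
assert (Ex : nome u = x) by (unfold nome; rewrite <- Eln; apply exp_ln; lra).
assert (E0 : R0_1 x = exp (- (PI / 12 * u)) * exp (/ 4 * ln (1 + u ^ 2))).
{ unfold R0_1, Rpower.
  replace (PI ^ 2 / (6 * ln x)) with (- (PI / 12 * u)) by (rewrite Eln; field; lra).
  replace (4 * PI ^ 2 / ln x ^ 2) with (u ^ 2) by (rewrite Eln; field; lra).
  do 2 f_equal; field. }
assert (E1 : R_1 x = exp (log_ratio u) * R0_1 x).
{ rewrite E0, <- !exp_plus.
  replace (log_ratio u + (- (PI / 12 * u) + / 4 * ln (1 + u ^ 2))) with (log_euler u) by (unfold log_ratio; ring).
  unfold log_euler; rewrite Ex, exp_ln; [reflexivity|apply (ln_R_1_lim x Hx)]. }
assert (P0 : 0 < R0_1 x) by (rewrite E0; apply Rmult_lt_0_compat; apply exp_pos).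
repeat split.
- rewrite E0.
  replace (PI ^ 2 / (6 * ln x)) with (- (PI / 12 * u)) by (rewrite Eln; field; lra).
  assert (0 < u ^ 2) by (apply pow_lt; exact Hu).
  assert (0 < ln (1 + u ^ 2)) by (rewrite <- ln_1; apply ln_increasing; lra).
  assert (H1 := exp_ineq1 (/ 4 * ln (1 + u ^ 2)) ltac:(lra)).
  assert (H2 := exp_pos (- (PI / 12 * u))); nra.
- rewrite E1; assert (H := log_ratio_pos u Hu).
  assert (H1 := exp_ineq1 (log_ratio u) ltac:(lra)); nra.
- rewrite E1, C_const_exp; apply Rmult_le_compat_r; [lra|].
  destruct (log_ratio_max u Hu) as [H|H]; [left; apply exp_increasing, H|rewrite H; lra].
Qed.
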